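(* Let $k$ be a finite field with an even number $q$ of elements. For any $m\geq 1$, any pair $(\mathbf{n};\mathbf{r})\in\mathcal{N}_m$ and any integer $g\ge-1$, $$\sum_{j=0}^{g+1}\hat b_j\,u_{g-j}=\begin{cases} J\,q^{g+1}\,\hat b_{g+1} & \text{if } r_i=2 \text{ for all } i \text{ and } g\ge -1;\\ 0 & \text{if } r_i=1 \text{ for some } i \text{ and } g\ge \frac{|\mathbf{n}|-3}{2},\end{cases}$$ where $u_g=u_g^{(\mathbf{n};\mathbf{r})}$, $\hat b_j=\hat b_j^{\mathbf{n}}$ and $J=J^{\mathbf n}$.
   Context: Let $k$ be a finite field with $q$ elements, $q$ even, $k_m$ its extension of degree $m$ in an algebraic closure $\bar k$, and $F$ the Frobenius $x\mapsto x^q$ on $\mathbb{P}^1(\bar k)$. For $g\ge-1$ let $P_g$ be the set of pairs $(h,f)$ of polynomials over $k$, $h\ne0$, such that (1) $2g+1\le\max(2\deg h,\deg f)\le 2g+2$; (2) $\gcd(h,f'^2+fh'^2)=1$; (3) $t\nmid\gcd(h_\infty,f_\infty'^2+f_\infty h_\infty'^2)$, where $h_\infty:=t^{g+1}h(1/t)$ and $f_\infty:=t^{2g+2}f(1/t)$. For $(h,f)\in P_g$ let $h(\infty)$ and $f(\infty)$ be the coefficient of $x^{g+1}$ in $h$ and of $x^{2g+2}$ in $f$. Let $\tau_m:k_m^2\to\{1,0,-1\}$ send $(a,b)$ to $1$, $0$ or $-1$ if $y^2+ay+b=0$ has two, one or no roots in $k_m$. Put $I:=(q^3-q)^{-1}(q-1)^{-1}$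 and $I_g:=q^{-(g+2)}I$. $\mathcal{N}_m$ is the set of pairs $(\mathbf{n};\mathbf{r})$ with $\mathbf{n}=(n_1,\dots,n_m)\in\mathbb{Z}_{\ge1}^m$ and $\mathbf{r}=(r_1,\dots,r_m)\in\{1,2\}^m$; $|\mathbf{n}|:=\sum_i n_i$. $A(\mathbf{n})$ is the set of tuples $(\alpha_1,\dots,\alpha_m)\in\prod_{i}\mathbb{P}^1(k_{n_i})$ such that for all $1\le i,j\le m$ and $s\ge0$: $F^s(\alpha_i)=\alpha_j$ implies $n_i\mid s$ and $i=j$. Put $A'(\mathbf{n}):=A(\mathbf{n})\cap\prod_i\mathbb{A}^1(k_{n_i})$. For $g\ge-1$, $$u_g^{(\mathbf{n};\mathbf{r})}:=\sum_{\alpha\in A(\mathbf{n})}I_g\sum_{(h,f)\in P_g}\prod_{i=1}^m\tau_{n_i}\bigl(h(\alpha_i),f(\alpha_i)\bigr)^{r_i}.$$ For $j\ge0$, $b_j=b_j^{\mathbf{n}}$ is the number of monic polynomials $l$ over $k$ of degree $j$ with $l(\alpha_i)\ne0$ for all $i$, for any $\alpha\in A'(\mathbf{n})$; this does not depend on $\alpha$ and is given by $$b_j=q^j+\sum_{i=1}^j(-1)^i\sum_{\substack{1\le m_1<\dots<m_i\le m\\ n_{m_1}+\dots+n_{m_i}\le j}}q^{\,j-(n_{m_1}+\dots+n_{m_i})},$$ which is taken as the definition also if $A'(\mathbf{n})$ is empty. Put $\hat b_j=\hat b_j^{\mathbf n}:=\sum_{i=0}^j b_i$ and $J:=I\,(q-1)\,|A(\mathbf{n})|$.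 *)

(* Defs.v *)
From HB Require Import structures.
From mathcomp Require Import all_boot all_order all_algebra all_fingroup.
From mathcomp Require Import all_solvable all_field finmap.
From mathcomp Require Import mathcomp_extra boolp classical_sets functions.
From mathcomp Require Import cardinality fsbigop.

Set Implicit Arguments.
Unset Strict Implicit.
Unset Printing Implicit Defensive.

Import Order.TTheory GRing.Theory Num.Theory.

Local Open Scope classical_set_scope.
Local Open Scope ring_scope.

(* Throughout, [k] is the finite base field, [q = #|k|], and [iota : k -> K] is
   an algebraic closure of [k] (the theorem assumes [integralRange iota], that
   is, every element of [K] is algebraic over [k]). *)

Definition Frob (k : finFieldType) (K : closedFieldType) (x : K) : K :=
  x ^+ #|k|.

(* The extension k_m of k of degree m inside K, as the fixed points of F^m;
   [kext_subfield] and [kext_card] below confirm that, for m >= 1, this is a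
   subfield of K containing k and having q^m elements. *)
Definition kext (k : finFieldType) (K : closedFieldType) (m : nat) : set K :=
  [set x | iter m (@Frob k K) x = x].

(* P^1(K) is [option K], with [None] the point at infinity. *)
Definition FrobP1 (k : finFieldType) (K : closedFieldType)
  (x : option K) : option K := omap (@Frob k K) x.

Definition P1ext (k : finFieldType) (K : closedFieldType) (m : nat) :
  set (option K) := Some @` kext k m `|` [set None].

(* t^N p(1/t), for p of degree at most N. *)
Definition revpoly (R : nzRingType) (N : nat) (p : {poly R}) : {poly R} :=
  \poly_(i < N.+1) p`_(N - i).

(* f'^2 + f h'^2 *)
Definition ramif (R : nzRingType) (h f : {poly R}) : {poly R} :=
  f^`() ^+ 2 + f * h^`() ^+ 2.

(* The set P_g, meant for g >= -1, so that g + 1 and 2g + 2 are natural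
   numbers and the uses of [absz] below have no effect. The degree of [p] is
   [(size p).-1], which is 0 for [p = 0]; this convention is immaterial for
   [f = 0], since [h != 0]. *)
Definition Pg (k : finFieldType) (g : int) : set ({poly k} * {poly k}) :=
  [set hf | let: (h, f) := hf in
    let hoo := revpoly (absz (g + 1)) h in
    let foo := revpoly (absz (2 * g + 2)) f in
    let d := maxn (2 * (size h).-1) (size f).-1 in
    [/\ h != 0,
        2 * g + 1 <= d%:Z <= 2 * g + 2,
        coprimep h (ramif h f)
      & ~~ ('X %| gcdp hoo (ramif hoo foo))]].

Arguments Pg k g _ : clear implicits.

(* The value of p at a point of P^1(K); at infinity it is the coefficient of
   x^N, with N = g + 1 for h and N = 2g + 2 for f. *)
Definition evalP1 (k : finFieldType) (K : closedFieldType)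
  (iota : {rmorphism k -> K}) (N : nat) (p : {poly k}) (x : option K) : K :=
  if x is Some a then (map_poly iota p).[a] else iota p`_N.

Definition quad_roots (k : finFieldType) (K : closedFieldType) (m : nat)
  (a b : K) : set K :=
  [set y | kext k m y /\ y ^+ 2 + a * y + b = 0].

Definition tau (k : finFieldType) (K : closedFieldType) (m : nat) (a b : K) :
  rat :=
  match #|` fset_set (quad_roots k m a b)| with
  | 2%N => 1
  | 1%N => 0
  | _ => - 1
  end.

Definition An (k : finFieldType) (K : closedFieldType) (m : nat)
  (n : 'I_m -> nat) : set {ffun 'I_m -> option K} :=
  [set a | (forall i, P1ext k (n i) (a i)) /\
    (forall (i j : 'I_m) (s : nat), iter s (@FrobP1 k K) (a i) = a j ->
      (n i %| s)%N /\ i = j)].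

Arguments An k K {m} n _.

Definition Iconst (k : finFieldType) : rat :=
  let q : rat := #|k|%:R in (q ^+ 3 - q)^-1 * (q - 1)^-1.

Definition Ig (k : finFieldType) (g : int) : rat :=
  (#|k|%:R : rat) ^ (- (g + 2)) * Iconst k.

Definition ug (k : finFieldType) (K : closedFieldType)
  (iota : {rmorphism k -> K}) (m : nat) (n r : 'I_m -> nat) (g : int) : rat :=
  \sum_(a \in An k K n)
    (Ig k g * \sum_(hf \in Pg k g)
       \prod_(i < m) tau k (n i) (evalP1 iota (absz (g + 1)) hf.1 (a i))
                                 (evalP1 iota (absz (2 * g + 2)) hf.2 (a i))
                     ^+ r i).

(* A strictly increasing tuple m_1 < ... < m_i of indices is encoded by the
   subset [S] of cardinality i that it enumerates. *)
Definition bcoef (k : finFieldType) (m : nat) (n : 'I_m -> nat) (j : nat) :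
  rat :=
  let q : rat := #|k|%:R in
  q ^+ j + \sum_(1 <= i < j.+1) (-1) ^+ i *
    \sum_(S : {set 'I_m} | (#|S| == i) && (\sum_(l in S) n l <= j)%N)
       q ^+ (j - \sum_(l in S) n l)%N.

Definition bhat (k : finFieldType) (m : nat) (n : 'I_m -> nat) (j : nat) :
  rat := \sum_(0 <= i < j.+1) bcoef k n i.

Definition Jconst (k : finFieldType) (K : closedFieldType) (m : nat)
  (n : 'I_m -> nat) : rat :=
  Iconst k * (#|k|%:R - 1) * #|` fset_set (An k K n)|%:R.

Lemma iter_Frob (k : finFieldType) (K : closedFieldType) (m : nat) (x : K) :
  iter m (@Frob k K) x = x ^+ (#|k| ^ m)%N.
Proof.
elim: m => [|m IHm]; first by rewrite expn0 expr1.
by rewrite iterS IHm /Frob -exprM expnSr.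
Qed.

Lemma kext_subfield (k : finFieldType) (K : closedFieldType)
  (iota : {rmorphism k -> K}) (m : nat) :
  [/\ forall c, kext k m (iota c),
      forall x y : K, kext k m x -> kext k m y -> kext k m (x - y)
    & forall x y : K, kext k m x -> kext k m y -> kext k m (x / y)].
Proof.
have kc c : kext k m (iota c).
  rewrite /kext /= iter_Frob -rmorphXn /=; congr (iota _).
  by elim: m => [|m IHm]; rewrite ?expn0 ?expr1// expnSr exprM IHm expf_card.
split=> // x y; rewrite /kext /= !iter_Frob => xE yE; last first.
  by rewrite expr_div_n xE yE.
have [p pr_p pcharKp] := finPcharP k.
have pK : p \in [pchar K] by rewrite (fmorph_pchar iota).
have pn : [pchar K].-nat (#|k| ^ m)%N.
  rewrite (eq_pnat _ (pcharf_eq pK)) (card_pprimeChar pcharKp) pnatX.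
  by rewrite pnatX pnat_id.
have := kc (-1); rewrite /kext /= iter_Frob rmorphN1 => N1E.
by rewrite -mulN1r exprDn_pchar // exprMn N1E xE yE.
Qed.

Lemma kext_card (k : finFieldType) (K : closedFieldType)
  (iota : {rmorphism k -> K}) (m : nat) : (0 < m)%N ->
  finite_set (kext k m : set K) /\
  #|` fset_set (kext k m : set K)| = (#|k| ^ m)%N.
Proof.
move=> m_gt0; set N := (#|k| ^ m)%N.
have N_gt1 : (1 < N)%N by rewrite -(exp1n m) ltn_exp2r// finNzRing_gt1.
pose P : {poly K} := 'X^N - 'X.
have sX : (size (- 'X : {poly K}) < size ('X^N : {poly K}))%N.
  by rewrite size_polyN size_polyX size_polyXn.
have sP : size P = N.+1 by rewrite size_polyDl // size_polyXn.
have mP : P \is monic by rewrite monicE lead_coefDl // lead_coefXn.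
have N0 : N%:R = 0 :> K.
  have [p pr_p pcharKp] := finPcharP k.
  have pK : p \in [pchar K] by rewrite (fmorph_pchar iota).
  apply/eqP; rewrite -(dvdn_pcharf pK) /N Euclid_dvdX // m_gt0 andbT.
  rewrite (dvdn_pcharf pcharKp) -[_%:R]FinRing.zmodXgE -cardsT.
  by rewrite -order_dvdn order_dvdG ?inE.
have [s Ps] := closed_field_poly_normal P.
rewrite (monicP mP) scale1r in Ps.
have us : uniq s.
  rewrite -separable_prod_XsubC -Ps separable_poly.unlock derivB derivX derivXn.
  by rewrite -mulr_natl -polyC_natr N0 polyC0 mul0r sub0r coprimep_sym -scaleN1r
     coprimepZl ?coprime1p ?oppr_eq0 ?oner_eq0.
have kE : kext k m = [set` s] :> set K.
  apply/seteqP; split=> x /=; rewrite /kext /= iter_Frob -/N -root_prod_XsubC;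
    rewrite -Ps rootE !hornerE ?hornerXn subr_eq0.
  - by move=> ->.
  - by move/eqP.
have fs : finite_set [set` s] by exact: finite_seq.
split; first by rewrite kE.
have -> : fset_set (kext k m : set K) = [fset x in s]%fset.
  by apply/fsetP => x; rewrite kE in_fset_set // in_fset; apply/idP/idP;
    rewrite inE.
rewrite card_fseq undup_id //; apply: succn_inj.
by rewrite -/N -sP Ps size_prod_XsubC.
Qed.

(* Main.v *)
Require Import Defs.
From HB Require Import structures.
From mathcomp Require Import all_boot all_order all_algebra.
From mathcomp Require Import all_field finmap.
From mathcomp Require Import boolp classical_sets.
From mathcomp Require Import cardinality fsbigop.
From mathcomp Require Import zify ring.

Set Implicit Arguments.
Unset Strict Implicit.
Unset Printing Implicit Defensive.

Import Order.TTheory GRing.Theory Num.Theory.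

Local Open Scope ring_scope.

(* Put N = g + 1 and consider all equations y^2 + h y + f = 0 with h <> 0,
   deg h <= N and deg f <= 2N. Each of them is obtained, for a unique j, from a
   pair (h', f') in P_(g-j) as h = l h', f = l^2 f' + p^2 + l h' p with l <> 0 of
   degree at most j and deg p <= N, and this in exactly (q - 1) q^(N-j+1) ways.
   Such a reduction multiplies the product of the tau's by 1 if l vanishes at
   none of the alpha_i, and by 0 otherwise. There are (q - 1) bhat_j suitable l,
   by inclusion-exclusion, and hence sum_j bhat_j u_(g-j) is, up to a constant,
   the sum of the product of the tau's over all the pairs (h, f).
   If all r_i are 2, this counts the h without zeros at the alpha_i. If r_i = 1,
   then f can be translated, once 2g + 3 >= |n|, by a polynomial f_0 that
   vanishes at the other alpha_j and whose value at alpha_i interchanges split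
   and nonsplit equations, so that the sum is its own opposite. *)

(* Membership in P_(N-1), see [reduced_Pg]. The truncated [N.-1] is harmless:
   for [N = 0] the polynomial [h] is a nonzero constant, so that [h`_N != 0]. *)
Definition reduced (k : fieldType) (N : nat) (h f : {poly k}) : bool :=
  [&& h != 0, (size h <= N.+1)%N, (size f <= (2 * N).+1)%N,
      coprimep h (ramif h f)
    & (h`_N != 0) || (f`_(2 * N).-1 ^+ 2 + f`_(2 * N) * h`_N.-1 ^+ 2 != 0)].

Lemma coefM_top (R : nzRingType) (p1 p2 : {poly R}) a b : (size p1 <= a.+1)%N
  -> (size p2 <= b.+1)%N ->
  (p1 * p2)`_(a + b) = p1`_a * p2`_b.
Proof.
move=> s1 s2; have aL : (a < (a + b).+1)%N by rewrite ltnS leq_addr.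
rewrite coefM (bigD1 (Ordinal aL)) //= addKn big1 ?addr0 // => i ia.
have {}ia : (i : nat) != a by [].
case: (ltnP a i) => ai; first by rewrite [p1`_i]nth_default ?mul0r //
  (leq_trans s1).
rewrite [p2`__]nth_default ?mulr0 // (leq_trans s2) //; lia.
Qed.

(** * Uniqueness of the reduction in characteristic 2 *)

Section Char2.
Variable k : fieldType.
Hypothesis k2 : 2%N \in [pchar k].
Implicit Types p h f l d u v w : {poly k}.

Lemma addpp2 p : p + p = 0.
Proof. by apply: addrr_pchar2; rewrite pchar_poly. Qed.

Lemma addcc2 (c : k) : c + c = 0.
Proof. exact: addrr_pchar2. Qed.

Lemma oppp2 p : - p = p.
Proof. by apply: oppr_pchar2; rewrite pchar_poly. Qed.

Lemma sqrp2D p1 p2 : (p1 + p2) ^+ 2 = p1 ^+ 2 + p2 ^+ 2.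
Proof. by rewrite sqrrD [p1 * p2 *+ 2]mulr2n addpp2 addr0. Qed.

Lemma deriv_sqr2 p : (p ^+ 2)^`() = 0.
Proof. by rewrite expr2 derivM mulrC addpp2. Qed.

Lemma coef_sqr2 p i : (p ^+ 2)`_i = if odd i then 0 else p`_i./2 ^+ 2.
Proof.
elim/poly_ind: p i => [|p c IH] i;
  first by rewrite expr2 mul0r !coef0 expr2 mul0r if_same.
rewrite sqrp2D exprMn -polyC_exp coefD coefMXn coefC.
have E : (p * 'X + c%:P)`_i./2 = if (i./2 == 0)%N then c else p`_(i./2).-1.
  by rewrite -cons_poly_def coef_cons; case: (i./2).
rewrite E. case: i {E} => [|[|i]] //=; rewrite ?addr0 ?add0r //.
by rewrite negbK subn2 /= IH.
Qed.

(** Two reductions of one equation lead to this relation, with [h1 = v * w] and [h2 = u * w]. Modulo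
    [v] it gives u^2 f1 = d^2 and, after differentiation, u^2 f1' = u v' w d. Since (v w)' = v' w
    modulo [v], the two terms of u^4 [ramif] coincide and cancel. *)
Lemma dvdp_ramif u v w d f1 f2 :
  u ^+ 2 * f1 + v ^+ 2 * f2 = d ^+ 2 + u * v * w * d ->
  v %| u ^+ 4 * ramif (v * w) f1.
Proof.
move=> E.
have E' : u ^+ 2 * f1 = d ^+ 2 + v * (u * w * d + v * f2).
  rewrite -[LHS]addr0 -(addpp2 (v ^+ 2 * f2)) addrA E; ring.
set B := u * w * d + v * f2 in E'.
have := congr1 (@deriv k) E'.
rewrite derivM deriv_sqr2 mul0r add0r derivD deriv_sqr2 add0r derivM => D.
have D' : u ^+ 2 * f1^`() = u * v^`() * w * d + v * (f2 * v^`() + B^`()).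
  rewrite D /B; ring.
rewrite /ramif derivM.
set e := v^`() * w.
have -> : u ^+ 4 * (f1^`() ^+ 2 + f1 * (e + v * w^`()) ^+ 2) =
  (u ^+ 2 * f1^`()) ^+ 2 + u ^+ 2 * (u ^+ 2 * f1) * (e + v * w^`()) ^+ 2 by ring.
rewrite D' E'.
set C := f2 * v^`() + B^`().
have -> : u * v^`() * w * d = u * e * d by rewrite /e; ring.
set G := (u * e * d) ^+ 2.
have -> : (u * e * d + v * C) ^+ 2 + u ^+ 2 * (d ^+ 2 + v * B) * (e + v *
  w^`()) ^+ 2
 = (G + G) + v * (2 * (u * e * d) * C + v * C ^+ 2 + u ^+ 2 * (d ^+ 2 * (2 * e
   * w^`() + v * w^`() ^+ 2) + B * (e + v * w^`()) ^+ 2)) by rewrite /G; ring.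
by rewrite addpp2 add0r dvdp_mulr.
Qed.

(** As [v] is prime to [u ^+ 4], [dvdp_ramif] makes it a common divisor of a coprime pair. *)
Lemma reduced_unit u v w d f1 f2 :
  u ^+ 2 * f1 + v ^+ 2 * f2 = d ^+ 2 + u * v * w * d ->
  coprimep u v -> coprimep (v * w) (ramif (v * w) f1) -> size v = 1%N.
Proof.
move=> E uv cop; have := dvdp_ramif E.
rewrite Gauss_dvdpr => [vr|]; last by rewrite coprimep_sym coprimep_expl.
by move/coprimepP: cop => /(_ v (dvdp_mulr _ (dvdpp v)) vr) /eqp_size;
  rewrite size_poly1.
Qed.

(** With deg d > M the square of [d] would dominate [u * v * w * d], as [u] and [v] are constants,
    and the right-hand side would have degree above 2M. *)
Lemma size_quadratic M u v w d f1 f2 :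
  u ^+ 2 * f1 + v ^+ 2 * f2 = d ^+ 2 + u * v * w * d ->
  size u = 1%N -> size v = 1%N -> (size w <= M.+1)%N ->
  (size f1 <= (2 * M).+1)%N -> (size f2 <= (2 * M).+1)%N ->
  (size d <= M.+1)%N.
Proof.
move=> E su sv sw s1 s2; rewrite leqNgt; apply/negP => sd.
have d0 : d != 0 by apply: contraTneq sd => ->; rewrite size_poly0.
have /size_poly1P[c c0 uE] : size u == 1%N by rewrite su.
have /size_poly1P[e e0 vE] : size v == 1%N by rewrite sv.
have L : (size (u ^+ 2 * f1 + v ^+ 2 * f2)%R <= (2 * M).+1)%N.
  apply: (leq_trans (size_polyD _ _)).
  by rewrite uE vE -!polyC_exp !size_Cmul ?expf_neq0 // geq_max s1.
have sdd : size (d ^+ 2)%R = ((size d).*2).-1 by rewrite expr2 size_mul // addnn.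
have lt : (size (u * v * w * d)%R < size (d ^+ 2)%R)%N.
  rewrite uE vE -polyCM -mulrA size_Cmul ?mulf_neq0 //.
  by rewrite sdd; apply: (leq_ltn_trans (size_polyMleq _ _)); move: sw sd;
    set a := size w; set b := size d; lia.
by move: L; rewrite E size_polyDl // sdd; lia.
Qed.

(** The analogue of [dvdp_ramif] at infinity: a second pair that fits the smaller bound [M] would
    make the first one violate its condition at infinity. *)
Lemma reduced_infty M u v w d f1 f2 :
  u ^+ 2 * f1 + v ^+ 2 * f2 = d ^+ 2 + u * v * w * d ->
  size u = 1%N -> size v = 1%N -> (size w <= M.+1)%N ->
  (size f2 <= (2 * M).+1)%N -> reduced M.+1 (v * w) f1 -> False.
Proof.
move=> E su sv sw s2 /and5P[_ _ s1 _].
have sd := size_quadratic E su sv (leq_trans sw (leqnSn _)) s1 (leq_trans s2 _).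
have {}sd : (size d <= M.+2)%N by apply: sd; lia.
have /size_poly1P[c c0 uE] : size u == 1%N by rewrite su.
have /size_poly1P[e e0 vE] : size v == 1%N by rewrite sv.
rewrite uE vE -!polyC_exp -!mulrA in E *.
have -> : (2 * M.+1 = (M.+1).*2)%N by lia.
rewrite doubleS /= !coefCM [w`_M.+1]nth_default // mulr0 eqxx /=.
(* The two top coefficients give c^2 f1_(2M+2) = d_(M+1)^2 and c^2 f1_(2M+1) = c e w_M d_(M+1). *)
have := congr1 (fun p => p`_(M.*2).+2) E.
have := congr1 (fun p => p`_(M.*2).+1) E.
rewrite !coefD !coefCM !coef_sqr2 /= odd_double /= doubleK.
have -> : (w * d)`_(M.*2).+2 = 0.
  rewrite nth_default //; apply: (leq_trans (size_polyMleq _ _)); move: sw sd;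
    set a := size w; set b := size d; lia.
have -> : (M.*2).+1 = (M + M.+1)%N by lia.
rewrite coefM_top // [f2`__]nth_default; last by apply: (leq_trans s2); lia.
rewrite [f2`__]nth_default; last by apply: (leq_trans s2); lia.
rewrite !mulr0 !addr0 add0r => E1 E2 /negP[]; apply/eqP.
have : c ^+ 4 * (f1`_(M + M.+1) ^+ 2 + f1`_(M + M.+1).+1 * (e * w`_M) ^+ 2) = 0.
  have -> : c ^+ 4 * (f1`_(M + M.+1) ^+ 2 + f1`_(M + M.+1).+1 * (e * w`_M) ^+ 2) = 
    (c ^+ 2 * f1`_(M + M.+1)) ^+ 2 + c ^+ 2 * (c ^+ 2 * f1`_(M + M.+1).+1) * (e
      * w`_M) ^+ 2 by ring.
  rewrite E1 E2 -[RHS](addcc2 ((c * (e * (w`_M * d`_M.+1))) ^+ 2)); ring.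
by move/eqP; rewrite mulf_eq0 expf_eq0 /= (negPf c0) /= => /eqP.
Qed.

Lemma coprimep_cofactors (p1 p2 : {poly k}) : p1 != 0 ->
  exists2 e : {poly k}, e != 0 &
    exists u v, [/\ p1 = e * u, p2 = e * v & coprimep u v].
Proof.
move=> p10; exists (gcdp p1 p2); first by rewrite gcdp_eq0 negb_and p10.
exists (p1 %/ gcdp p1 p2), (p2 %/ gcdp p1 p2).
by rewrite ![gcdp _ _ * _]mulrC !divpK ?dvdp_gcdl ?dvdp_gcdr ?coprimep_div_gcd ?p10.
Qed.

(** The quotient d / e is a root of the monic polynomial T^2 + Y T - X, and k[x] is integrally
    closed. *)
Lemma dvdp_quadratic (e d X Y : {poly k}) : e != 0 ->
  d ^+ 2 + e * Y * d = e ^+ 2 * X -> e %| d.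
Proof.
move=> e0 E.
have [g g0 [e1 [d1 [eE dE cop]]]] := coprimep_cofactors d e0.
have : e1 %| d1 ^+ 2.
  have : d1 ^+ 2 = e1 * (e1 * X - Y * d1).
    apply: (mulIf (expf_neq0 2 g0)).
    have -> : d1 ^+ 2 * g ^+ 2 = d ^+ 2 by rewrite dE; ring.
    have -> : d ^+ 2 = e ^+ 2 * X - e * Y * d by rewrite -E; ring.
    rewrite {1 2}eE {1}dE; ring.
  by move=> ->; rewrite dvdp_mulr.
rewrite Gauss_dvdpl ?coprimep_expr // => e1d.
have : e1 %| 1 by rewrite -(Gauss_dvdpr 1 cop) mulr1.
rewrite dvdp1 => /eqP s1.
have /size_poly1P[c c0 e1E] : size e1 == 1%N by rewrite s1.
by rewrite eE dE e1E mulrC mul_polyC dvdpZl // dvdp_mulr.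
Qed.

(** Cancelling the common factor of [l1] and [l2] leaves coprime cofactors [u] and [v], which are
    constants because both pairs are reduced. Two reductions thus differ only by a scalar [c] and a
    translation [d], the freedom counted in [fibre_card]. *)
Lemma reduction_unique M1 M2 l1 l2 h1 h2 f1 f2 p1 p2 :
  l1 != 0 -> reduced M1 h1 f1 -> reduced M2 h2 f2 ->
  l1 * h1 = l2 * h2 ->
  l1 ^+ 2 * f1 + p1 ^+ 2 + l1 * h1 * p1 = l2 ^+ 2 * f2 + p2 ^+ 2 + l2 * h2 * p2 ->
  M1 = M2 /\ exists c d, [/\ c != 0, (size d <= M1.+1)%N, l2 = c *: l1,
     h2 = c^-1 *: h1 & p2 = p1 + l1 * d /\ f2 = c^-1 ^+ 2 *: (f1 + d ^+ 2 + h1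
       * d)].
Proof.
move=> l10 r1 r2 hE fE.
have h10 : h1 != 0 by case/and5P: r1.
have l20 : l2 != 0 by apply/eqP=> l20; move/eqP: hE;
  rewrite l20 mul0r mulf_eq0 (negPf l10) (negPf h10).
have [e e0 [u [v [l1E l2E uv]]]] := coprimep_cofactors l2 l10.
have u0 : u != 0 by apply: contraNneq l10; rewrite l1E => ->; rewrite mulr0.
have v0 : v != 0 by apply: contraNneq l20; rewrite l2E => ->; rewrite mulr0.
have uvh : u * h1 = v * h2.
  by apply: (mulfI e0); rewrite !mulrA -l1E -l2E.
have [w h1E] : exists w, h1 = v * w.
  have : v %| u * h1 by rewrite uvh dvdp_mulr.
  rewrite Gauss_dvdpr 1?coprimep_sym //.
  by case/dvdpP=> w ->; exists w; rewrite mulrC.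
have h2E : h2 = u * w by apply: (mulfI v0); rewrite -uvh h1E; ring.
pose d := p1 + p2.
have dE : d ^+ 2 + e * (u * v * w) * d = e ^+ 2 * (u ^+ 2 * f1 + v ^+ 2 * f2).
  rewrite /d sqrp2D l1E l2E h1E h2E in fE *.
  apply/eqP; rewrite -subr_eq0 oppp2.
  have -> : p1 ^+ 2 + p2 ^+ 2 + e * (u * v * w) * (p1 + p2) + e ^+ 2 * (u ^+ 2
    * f1 + v ^+ 2 * f2) = ((e * u) ^+ 2 * f1 + p1 ^+ 2 + e * u * (v * w) * p1)
      + ((e * v) ^+ 2 * f2 + p2 ^+ 2 + e * v * (u * w) * p2) by ring.
  by rewrite fE addpp2.
have /dvdpP[d1 d1E] : e %| d by apply: dvdp_quadratic dE.
have E : u ^+ 2 * f1 + v ^+ 2 * f2 = d1 ^+ 2 + u * v * w * d1.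
  apply: (mulfI (expf_neq0 2 e0)); rewrite -dE d1E; ring.
have E' : v ^+ 2 * f2 + u ^+ 2 * f1 = d1 ^+ 2 + v * u * w * d1.
  by rewrite addrC E [v * u]mulrC.
have sv : size v = 1%N.
  by apply: (reduced_unit E) => //; rewrite -h1E; case/and5P: r1.
have su : size u = 1%N.
  by apply: (reduced_unit E'); rewrite 1?coprimep_sym // -h2E coprimep_sym;
    case/and5P: r2.
have /size_poly1P[c c0 uE] : size u == 1%N by rewrite su.
have /size_poly1P[b b0 vE] : size v == 1%N by rewrite sv.
have sw1 : size w = size h1 by rewrite h1E vE size_Cmul.
have sw2 : size w = size h2 by rewrite h2E uE size_Cmul.
(* Otherwise the pair with the larger bound would violate its condition at infinity. *)
have MM : M1 = M2.
  case: (ltngtP M1 M2) => // lt.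
  - case: M2 r2 lt => // M2; rewrite ltnS h2E => r2 lt.
    have /and5P[_ b1 b2 _ _] := r1.
    case: (reduced_infty E' sv su _ _ r2).
      by rewrite sw1 (leq_trans b1).
    by rewrite (leq_trans b2) // ltnS leq_mul2l lt orbT.
  - case: M1 r1 lt => // M1; rewrite ltnS h1E => r1 lt.
    have /and5P[_ b1 b2 _ _] := r2.
    case: (reduced_infty E su sv _ _ r1).
      by rewrite sw2 (leq_trans b1).
    by rewrite (leq_trans b2) // ltnS leq_mul2l lt orbT.
split=> //; have /and5P[_ b1 b2 _ _] := r1; have /and5P[_ b3 b4 _ _] := r2.
(* Here [c] and [b] are the constants [u] and [v], so that l2 = e b = (b / c) l1 and p2 = p1 + e d1
   = p1 + l1 (d1 / c). *)
exists (b / c), (c^-1 *: d1); split.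
- by rewrite mulf_neq0 ?invr_eq0.
- rewrite size_scale ?invr_eq0 //.
  by apply: (size_quadratic E); rewrite ?sw1 //; rewrite MM.
- rewrite l2E l1E uE vE -[RHS]mul_polyC mulrCA -polyCM; congr (_ * _%:P).
  by rewrite mulfVK.
- rewrite h2E h1E uE vE -[RHS]mul_polyC mulrA -polyCM; congr (_%:P * _).
  by rewrite invf_div mulfVK.
split.
  rewrite l1E uE -scalerAr -mulrA mul_polyC -scalerAr scalerA mulVf // scale1r.
  by rewrite mulrC -d1E /d addrA addpp2 add0r.
have : v ^+ 2 * f2 = u ^+ 2 * f1 + d1 ^+ 2 + u * h1 * d1.
  rewrite h1E mulrA -[RHS]addrA -E addrA addpp2 add0r //.
rewrite uE vE invf_div -!polyC_exp !mul_polyC => /(congr1 (fun p => (b ^+ 2)^-1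
  *: p)).
rewrite scalerA mulVf ?expf_neq0 // scale1r => ->.
rewrite exprMn exprVn !scalerDr !scalerA exprZn !scalerA.
congr (_ + _ + _); first by congr (_ *: _); rewrite mulrC.
  by congr (_ *: _); field; rewrite ?c0 ?b0.
rewrite -scalerAl -scalerAr !scalerA; congr (_ *: _).
by rewrite expr2; field; rewrite c0 b0.
Qed.
End Char2.

(** * Existence of the reduction over a finite field of even order *)

Section FinChar2.
Variable k : finFieldType.
Hypothesis q_even : ~~ odd #|k|.
Implicit Types p h f l d u v w : {poly k}.

Lemma pchar2_even : 2%N \in [pchar k].
Proof.
have [p pr_p pcharkp] := finPcharP k.
move: q_even; rewrite (card_pprimeChar pcharkp) oddX negb_or => /andP[_].
by case: (even_prime pr_p) => [<- //|->].
Qed.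
Let k2 := pchar2_even.

Lemma sqrt_even (c : k) : exists b, b ^+ 2 = c.
Proof.
exists (c ^+ #|k|./2); rewrite -exprM muln2 -[RHS]expf_card; congr (_ ^+ _).
by rewrite -[RHS]odd_double_half (negPf q_even).
Qed.

(** Only even exponents survive, and the coefficients are squares because [k] is perfect. *)
Lemma deriv_eq0_sqr p : p^`() = 0 -> exists s, p = s ^+ 2.
Proof.
move=> p'0; have r i : exists b, b ^+ 2 == p`_i.*2.
  by have [b bE] := sqrt_even p`_i.*2; exists b; apply/eqP.
exists (\poly_(i < size p) xchoose (r i)); apply/polyP => i.
rewrite (coef_sqr2 k2); case: ifPn => [|/negPf] io.
  case: i io => // i io; have := congr1 (fun p => p`_i) p'0.
  rewrite coef_deriv coef0 -mulr_natr -[i.+1]odd_double_half io natrD -muln2 natrM.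
  by rewrite (pcharf0 k2) mulr0 addr0 mulr1 muln2 -[true]io odd_double_half.
rewrite coef_poly; have E : i = i./2.*2 by rewrite -[LHS]odd_double_half io.
case: ltnP => s; first by rewrite (eqP (xchooseP (r i./2))) -E.
by rewrite expr2 mul0r nth_default // (leq_trans s) // E doubleK -addnn leq_addr.
Qed.

Lemma irreducible_dvd_sqr (pi p : {poly k}) : irreducible_poly pi -> pi %| p ^+
  2 -> pi %| p.
Proof.
move=> irr; apply: contraTT; rewrite -!irreducible_poly_coprime // => cop.
exact: coprimep_expr.
Qed.

(** Otherwise the derivative, being of smaller degree, vanishes and [pi] is a square. *)
Lemma irreducible_deriv_coprimep (pi : {poly k}) : irreducible_poly pi ->
  coprimep pi pi^`().
Proof.
move=> irr; have [s irr2] := irr.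
rewrite irreducible_poly_coprime //; apply/negP => d.
have pi0 : pi != 0 by rewrite -size_poly_eq0 -lt0n ltnW.
have /deriv_eq0_sqr[t tE] : pi^`() = 0.
  apply/eqP; apply: contraTT d => nz;
    apply: contraL (lt_size_deriv pi0) => /(dvdp_leq nz).
  by rewrite -leqNgt.
have td : pi %| t by apply: (irreducible_dvd_sqr irr); rewrite -tE.
have t0 : t != 0 by apply: contraNneq pi0; rewrite tE => ->; rewrite expr2 mul0r.
have := dvdp_leq t0 td; rewrite {1}tE expr2 size_mul // => le.
move: s; rewrite tE expr2 size_mul //; lia.
Qed.

(** Squaring is injective on the finite set of residues modulo [pi], hence surjective. *)
Lemma sqrt_mod (pi f : {poly k}) : irreducible_poly pi ->
  exists2 p : {poly k}, (size p < size pi)%N & pi %| f + p ^+ 2.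
Proof.
move=> irr; have [s _] := irr.
have pi0 : pi != 0 by rewrite -size_poly_eq0 -lt0n ltnW.
set n := (size pi).-1; have nE : size pi = n.+1 by rewrite prednK // ltnW.
have sm p : (size (p %% pi)%R <= n)%N by rewrite -ltnS -nE ltn_modp.
pose phi (p : {poly_n k}) : {poly_n k} := NPoly (sm ((p : {poly k}) ^+ 2)).
have phi_inj : injective phi.
  move=> a b /(congr1 val) /= ab; apply: val_inj; apply/eqP.
  rewrite -subr_eq0; apply/negPn/negP => nz.
  have : pi %| val a - val b.
    apply: irreducible_dvd_sqr => //.
    rewrite -(oppp2 k2 (val b)) opprK (sqrp2D k2) -(oppp2 k2 (val b ^+ 2)).
    by rewrite /dvdp modpD modpN ab subrr.
  move/(dvdp_leq nz); apply/negP; rewrite -ltnNge nE ltnS.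
  by rewrite (leq_trans (size_polyD _ _)) // size_polyN geq_max !size_npoly.
have [psi _ psiK] := injF_bij phi_inj.
exists (psi (NPoly (sm f))); first by rewrite nE ltnS size_npoly.
have /(congr1 val) /= E := psiK (NPoly (sm f)).
by rewrite /dvdp modpD E -modpD addpp2 // mod0p.
Qed.

(** Translating y by [p] changes [ramif h f] by a multiple of [h], so the coprimality condition
    survives. *)
Lemma ramifD h f p : ramif h (f + p ^+ 2 + h * p) =
  ramif h f + h * (h * p^`() ^+ 2 + p * h^`() ^+ 2).
Proof.
rewrite /ramif !derivD deriv_sqr2 // addr0 derivM.
set fd := f^`(); set hd := h^`(); set pd := p^`().
rewrite !(sqrp2D k2) -[RHS]addr0 -(addpp2 k2 (p ^+ 2 * hd ^+ 2)); ring.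
Qed.

Lemma ramifZ h f c : ramif (c *: h) (c ^+ 2 *: f) = c ^+ 4 *: ramif h f.
Proof. rewrite /ramif !derivZ -!mul_polyC !polyC_exp; ring. Qed.

(** The converse of [reduction_unique]: every scalar and every translation that it allows does
    occur. *)
Lemma reduced_move N h f p c : c != 0 -> (size p <= N.+1)%N -> reduced N h f ->
  reduced N (c^-1 *: h) (c^-1 ^+ 2 *: (f + p ^+ 2 + h * p)).
Proof.
move=> c0 sp /and5P[h0 sh sf cop inf].
have ci0 : c^-1 != 0 by rewrite invr_eq0.
apply/and5P; split.
- by rewrite scaler_eq0 negb_or ci0.
- by rewrite size_scale.
- rewrite size_scale ?expf_neq0 // (leq_trans (size_polyD _ _)) // geq_max.
  rewrite (leq_trans (size_polyD _ _)) ?geq_max ?sf /=.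
    by apply: (leq_trans (size_polyMleq _ _)); move: sh sp; set a := size h;
      set b := size p; lia.
  by rewrite expr2; apply: (leq_trans (size_polyMleq _ _)); move: sp;
    set b := size p; lia.
- by rewrite coprimepZl // ramifZ coprimepZr ?expf_neq0 // ramifD mulrC addrC
  coprimep_addl_mul.
rewrite !coefZ; have [hN|hN] := eqVneq h`_N 0; last by rewrite mulf_neq0.
move: inf; rewrite hN mulr0 eqxx /= !coefD !coef_sqr2 //.
(* For [N = 0] the nonzero [h] is a constant, so its coefficient of index [N] cannot vanish. *)
case: N sp sh sf hN => [|N] sp sh sf hN.
  have /size_poly1P[b b0 hE] : size h == 1%N by rewrite eqn_leq sh lt0n
    size_poly_eq0.
  by move: hN; rewrite hE coefC /= => /eqP; rewrite (negPf b0).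
have sh' : (size h <= N.+1)%N.
  rewrite leqNgt; apply/negP => lt; have sE : size h = N.+2 by apply/eqP;
    rewrite eqn_leq sh lt.
  by move: h0; rewrite -lead_coef_eq0 lead_coefE sE /= hN eqxx.
have -> : (2 * N.+1 = (N.+1).*2)%N by rewrite mul2n.
rewrite doubleS /= odd_double /= doubleK.
have -> : (h * p)`_(N.*2).+2 = 0.
  rewrite nth_default //; apply: (leq_trans (size_polyMleq _ _)); move: sp sh';
    set a := size p; set b := size h; lia.
have -> : (h * p)`_(N.*2).+1 = h`_N * p`_N.+1.
  by rewrite -coefM_top //; congr _`_ _; lia.
(* The changes in the two top coefficients of [f] contribute the same term x^2 y^2 twice. *)
move=> nz; apply: contra nz => /eqP E; apply/eqP; move: E.
set a := f`__; set b := f`__; set x := h`_N; set y := p`__; rewrite !addr0.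
move=> E; apply: (mulfI (expf_neq0 4 ci0)); rewrite mulr0 -E.
have := addcc2 k2 (c^-1 ^+ 4 * x ^+ 2 * y ^+ 2).
move=> Z; rewrite -[LHS]addr0 -Z.
have := addcc2 k2 (c^-1 ^+ 4 * a * x * y).
move=> Z2; rewrite -[LHS]addr0 -Z2; ring.
Qed.

Lemma irreducible_factor p : (1 < size p)%N -> exists2 pi, irreducible_poly pi
  & pi %| p.
Proof.
have [n] := ubnP (size p); elim: n p => // n IH p /ltnSE sn sp.
have [irr|] := boolP (irreducibleb p).
  by exists p => //; apply/irreducibleP.
rewrite negb_and sp /= => /forallPn[q]; rewrite negb_imply -ltnNge => /andP[qp sq].
rewrite -Pdiv.Idomain.dvdpE in qp.
have [|pi irr piq] := IH q _ sq; last by exists pi => //; exact: dvdp_trans piq qp.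
by rewrite (leq_ltn_trans (size_npoly q)) // (leq_trans _ sn) // prednK // ltnW.
Qed.

(** After translation by a square root [p] of [f] modulo [pi], [pi] divides [F], and also F' because
    [ramif h F] is F'^2 modulo [pi]. Writing F = pi G, [pi] divides pi' G and hence [G], so pi^2
    divides [F]. *)
Lemma reduction_step_irreducible (pi h f : {poly k}) :
  irreducible_poly pi -> pi %| h -> pi %| ramif h f ->
  exists h1 f1 p, [/\ (size p < size pi)%N, h = pi * h1 &
     f = pi ^+ 2 * f1 + p ^+ 2 + pi * h1 * p].
Proof.
move=> irr pih pir; have [p sp pif] := sqrt_mod f irr.
have /dvdpP[h1 hE] := pih; rewrite mulrC in hE.
pose F := f + p ^+ 2 + h * p.
have piF : pi %| F by rewrite dvdp_addr // dvdp_mulr.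
have piF' : pi %| F^`().
  apply: irreducible_dvd_sqr => //.
  have : pi %| ramif h F by rewrite ramifD dvdp_addr // dvdp_mulr.
  by rewrite /ramif dvdp_addl // dvdp_mulr.
have /dvdpP[G FE] := piF.
have /dvdpP[f1 GE] : pi %| G.
  rewrite -(Gauss_dvdpl _ (irreducible_deriv_coprimep irr)).
  by move: piF'; rewrite FE derivM dvdp_addr // dvdp_mull.
exists h1, f1, p; split=> //; rewrite -hE.
have -> : pi ^+ 2 * f1 = F by rewrite FE GE; ring.
rewrite /F -[LHS]addr0 -(addpp2 k2 (p ^+ 2 + h * p)); ring.
Qed.

(** Induction on [N]. An irreducible common factor of [h] and [ramif h f] is divided out, which
    lowers [N] by its degree. A failure at infinity alone lowers [N] by 1 and leaves [l] unchanged,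
    as if [l] had gained a zero at infinity. *)
Lemma reduction_exists N h f :
  h != 0 -> (size h <= N.+1)%N -> (size f <= (2 * N).+1)%N ->
  exists j l p h1 f1, [/\ (j <= N)%N, (size l <= j.+1)%N, (size p <= N.+1)%N,
    reduced (N - j) h1 f1 & l != 0 /\ (h = l * h1 /\
    f = l ^+ 2 * f1 + p ^+ 2 + l * h1 * p)].
Proof.
elim/ltn_ind: N h f => N IH h f h0 sh sf.
have [cop|ncop] := boolP (coprimep h (ramif h f)); last first.
  have [pi irr pig] : exists2 pi, irreducible_poly pi & pi %| gcdp h (ramif h f).
    apply: irreducible_factor; rewrite ltn_neqAle eq_sym -/(coprimep _ _) ncop.
    by rewrite lt0n size_poly_eq0 gcdp_eq0 negb_and h0.
  have [] := reduction_step_irreducible irr (dvdp_trans pig (dvdp_gcdl _ _))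
    (dvdp_trans pig (dvdp_gcdr _ _)).
  move=> h1 [f1 [p [sp hE fE]]].
  have [spi _] := irr.
  have pi0 : pi != 0 by rewrite -size_poly_eq0 -lt0n ltnW.
  have h10 : h1 != 0 by apply: contraNneq h0; rewrite hE => ->; rewrite mulr0.
  (* The degree of [pi] is [e.+1]. *)
  have [e piE] : exists e, size pi = e.+2 by case: (size pi) spi => [|[|e]] //
    _; exists e.
  have sh1 : (e.+1 + size h1 <= N.+1)%N.
    by move: sh; rewrite hE size_mul // piE.
  have h1gt : (0 < size h1)%N by rewrite lt0n size_poly_eq0.
  have eN : (e.+1 <= N)%N by lia.
  have sf1 : (size f1 <= (2 * (N - e.+1)).+1)%N.
    have [->|f10] := eqVneq f1 0; first by rewrite size_poly0.
    have : (size (pi ^+ 2 * f1)%R <= (2 * N).+1)%N.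
      have -> : pi ^+ 2 * f1 = f + (p ^+ 2 + h * p).
        rewrite fE -hE -[LHS]addr0 -(addpp2 k2 (p ^+ 2 + h * p)); ring.
      rewrite (leq_trans (size_polyD _ _)) // geq_max sf.
      rewrite (leq_trans (size_polyD _ _)) // geq_max expr2.
      apply/andP; split; apply: (leq_trans (size_polyMleq _ _)).
        by move: sp eN; rewrite piE; clear; set a := size p; lia.
      by move: sp sh; rewrite piE; set a := size p; set b := size h; lia.
    rewrite size_mul ?expf_neq0 // expr2 size_mul // piE /=; move: eN; clear;
      set a := size f1; move=> eN sa. lia.
  have [||j [l [p' [h2 [f2 [jN sl sp' r [l0 [h1E f1E]]]]]]]] := IH (N - e.+1)%N
    _ h1 f1 h10 _ sf1.
    by move: eN; clear; lia.
    by move: sh1 eN; clear; lia.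
  exists (e.+1 + j)%N, (pi * l), (pi * p' + p), h2, f2; split.
  - by move: jN eN; clear; lia.
  - by rewrite size_mul // piE; move: sl; clear; set a := size l; lia.
  - rewrite (leq_trans (size_polyD _ _)) // geq_max; apply/andP; split.
      by apply: (leq_trans (size_polyMleq _ _)); rewrite piE; move: sp' eN;
        clear; set a := size p'; lia.
    by move: sp eN; rewrite piE; clear; set a := size p; lia.
  - by rewrite subnDA.
  split; first by rewrite mulf_neq0.
  split; first by rewrite hE h1E; ring.
  rewrite fE f1E h1E (sqrp2D k2); ring.
have [inf|] := boolP ((h`_N != 0) || (f`_(2 * N).-1 ^+ 2 + f`_(2 * N) * h`_N.-1
  ^+ 2 != 0)).
  exists 0%N, 1, 0, h, f; split; rewrite ?size_poly1 ?size_poly0 ?oner_eq0 //.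
    by rewrite subn0; apply/and5P; split.
  by rewrite expr1n !mul1r expr0n mulr0 !addr0.
rewrite negb_or !negbK => /andP[/eqP hN /eqP inf].
case: N IH sh sf hN inf => [|N] IH sh sf hN inf.
  have /size_poly1P[b b0 hE] : size h == 1%N by rewrite eqn_leq sh lt0n
    size_poly_eq0.
  by move: hN; rewrite hE coefC /= => /eqP; rewrite (negPf b0).
have sh' : (size h <= N.+1)%N.
  rewrite leqNgt; apply/negP => lt; have sE : size h = N.+2 by apply/eqP;
    rewrite eqn_leq sh lt.
  by move: h0; rewrite -lead_coef_eq0 lead_coefE sE /= hN eqxx.
(* Translation by c x^(N+1) kills the coefficient of x^(2N+2) in [f]. That of x^(2N+1) becomes
   f_(2N+1) + h_N c, whose square is the expression that vanishes at infinity. *)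
have [c cE] := sqrt_even f`_(2 * N.+1).
pose p := c *: 'X^(N.+1); pose F := f + p ^+ 2 + h * p.
have sp : (size p <= N.+2)%N by rewrite (leq_trans (size_scale_leq _ _)) //
  size_polyXn.
have pE : p`_N.+1 = c by rewrite coefZ coefXn eqxx mulr1.
have fE : f = F + p ^+ 2 + h * p.
  rewrite /F -[LHS]addr0 -(addpp2 k2 (p ^+ 2 + h * p)); ring.
have sF : (size F <= (2 * N).+1)%N.
  have sF : (size F <= (2 * N).+3)%N.
    rewrite (leq_trans (size_polyD _ _)) // geq_max; apply/andP; split; last first.
      by apply: (leq_trans (size_polyMleq _ _)); move: sh' sp; set a := size h;
        set b := size p; lia.
    rewrite (leq_trans (size_polyD _ _)) // geq_max; apply/andP; split.
      by apply: (leq_trans sf); lia.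
    by rewrite expr2; apply: (leq_trans (size_polyMleq _ _)); move: sp;
      set b := size p; lia.
  have e2 : (2 * N.+1 = (N.*2).+2)%N by lia.
  have F2 : F`_(2 * N).+2 = 0.
    rewrite /F !coefD coef_sqr2 // [(h * p)`__]nth_default; last first.
      by apply: (leq_trans (size_polyMleq _ _)); move: sh' sp; set a := size h;
        set b := size p; lia.
    have -> : (2 * N).+2 = (2 * N.+1)%N by lia.
    by rewrite {2 3}e2 /= odd_double /= doubleK pE cE addr0 addcc2.
  have F1 : F`_(2 * N).+1 = 0.
    rewrite /F !coefD coef_sqr2 // mul2n /= odd_double /= addr0.
    have -> : (h * p)`_(N.*2).+1 = h`_N * p`_N.+1 by rewrite -coefM_top //;
      congr _`_ _; lia.
    rewrite pE; apply/eqP; rewrite -sqrf_eq0 sqrrD; apply/eqP.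
    have := addcc2 k2 (f`_(N.*2).+1 * (h`_N * c)); rewrite -mulr2n => ->.
    by move: inf; rewrite addr0 exprMn [_ * c ^+ 2]mulrC cE e2.
  apply/leq_sizeP => i; rewrite leq_eqVlt => /predU1P[<-//|].
  rewrite leq_eqVlt => /predU1P[<-//|] si.
  by rewrite nth_default // (leq_trans sF).
have [|j [l [p' [h2 [f2 [jN sl sp' r [l0 [h1E f1E]]]]]]]] := IH N _ h F h0 sh'
  sF; first exact: ltnSn.
exists j.+1, l, (p' + p), h2, f2; split => //.
- exact: leqW.
- rewrite (leq_trans (size_polyD _ _)) // geq_max sp andbT; exact: leqW.
split=> //; split=> //.
by rewrite fE f1E h1E (sqrp2D k2); ring.
Qed.

End FinChar2.

(** * Counting the reductions of an equation *)

Section Fibres.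
Variable k : finFieldType.
Hypothesis q_even : ~~ odd #|k|.
Let k2 := pchar2_even q_even.

Definition npair (N : nat) : finType := ({poly_N.+1 k} * {poly_(2 * N).+1 k})%type.

Definition reduced_pair N (x : npair N) : bool := reduced N (polyn x.1) (polyn x.2).

(* The equation y^2 + h y + f = 0 after the substitution of (y + p) / l for y,
   with denominators cleared. *)
Definition unreduce N j (t : ({poly_j.+1 k} * {poly_N.+1 k}) * npair (N - j)) :
  npair N :=
  let: (l, p, (h, f)) := t in
  (npolyp N.+1 (polyn l * polyn h),
   npolyp (2 * N).+1 (polyn l ^+ 2 * polyn f + polyn p ^+ 2 + polyn l * polyn h
     * polyn p)).

Arguments unreduce : simpl never.

Lemma unreduceE N j (l : {poly_j.+1 k}) (p : {poly_N.+1 k}) (h : {poly_(N -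
  j).+1 k})
    (f : {poly_(2 * (N - j)).+1 k}) : (j <= N)%N ->
  polyn (unreduce (l, p, (h, f))).1 = polyn l * polyn h /\
  polyn (unreduce (l, p, (h, f))).2 =
    polyn l ^+ 2 * polyn f + polyn p ^+ 2 + polyn l * polyn h * polyn p.
Proof.
move=> jN; have := size_npoly l; have := size_npoly p; have := size_npoly h;
  have := size_npoly f.
move=> sf sh sp sl; have slh : (size (polyn l * polyn h)%R <= N.+1)%N.
  apply: (leq_trans (size_polyMleq _ _)).
  move: sl sh jN; set a := size _; set b := size _; lia.
split; rewrite /unreduce /= npolypK //.
rewrite (leq_trans (size_polyD _ _)) // geq_max; apply/andP; split; last first.
  by apply: (leq_trans (size_polyMleq _ _)); move: slh sp; set a := size _;
    set b := size _; lia.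
rewrite (leq_trans (size_polyD _ _)) // geq_max; apply/andP; split; last first.
  by rewrite expr2; apply: (leq_trans (size_polyMleq _ _)); move: sp;
    set a := size _; lia.
apply: (leq_trans (size_polyMleq _ _)).
have := size_polyMleq (polyn l) (polyn l); rewrite -expr2.
move: sl sf jN; set a := size _; set b := size _; set c := size _; lia.
Qed.

(** Once one reduction is fixed, all reductions correspond to the pairs (c, d) with c nonzero and
    deg d at most N - j0, and no other j occurs. *)
Lemma fibre_card N (x : npair N) : polyn x.1 != 0 ->
  exists2 j0, (j0 <= N)%N & forall j, (j <= N)%N ->
    #|[set t | (polyn t.1.1 != 0) && reduced_pair t.2 && (@unreduce N j t == x)]| =
    (if j == j0 then #|k|.-1 * #|k| ^ (N - j).+1 else 0)%N.
Proof.
case: x => h f /= h0; have sh := size_npoly h; have sf := size_npoly f.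
have [j0 [l [p [h1 [f1 [jN sl sp r [l0 [hE fE]]]]]]]] := reduction_exists
  q_even h0 sh sf.
exists j0 => // j jN'.
case: eqP => [-> | ne]; last first.
  apply/eqP; rewrite cards_eq0 -finset.subset0;
    apply/fintype.subsetP => -[[l2 p2] [h2 f2]].
  rewrite inE /= => /andP[/andP[l20 r2] /eqP E].
  have [E1 E2] := unreduceE l2 p2 h2 f2 jN'.
  rewrite E /= in E1 E2; rewrite E1 E2 in hE fE.
  have [MM _] := reduction_unique k2 l0 r r2 (esym hE) (esym fE).
  by case: ne; move: MM jN jN'; clear; lia.
have [_ sh1 sf1 _ _] := and5P r.
pose A := [set c : k * {poly_(N - j0).+1 k} | c.1 != 0].
pose G (c : k * {poly_(N - j0).+1 k}) : ({poly_j0.+1 k} * {poly_N.+1 k}) *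
  npair (N - j0) :=
  ((npolyp _ (c.1 *: l), npolyp _ (p + l * polyn c.2)),
   (npolyp _ (c.1^-1 *: h1), npolyp _ (c.1^-1 ^+ 2 *: (f1 + polyn c.2 ^+ 2 + h1
     * polyn c.2)))).
have GE c : c \in A -> [/\ polyn (G c).1.1 = c.1 *: l, polyn (G c).1.2 = p + l
  * polyn c.2,
   polyn (G c).2.1 = c.1^-1 *: h1,
   polyn (G c).2.2 = c.1^-1 ^+ 2 *: (f1 + polyn c.2 ^+ 2 + h1 * polyn c.2) &
   reduced_pair (G c).2].
  rewrite inE => c0.
  have rc := reduced_move q_even c0 (size_npoly c.2) r.
  have [_ s1 s2 _ _] := and5P rc.
  have s3 : (size (c.1 *: l)%R <= j0.+1)%N by rewrite (leq_trans
    (size_scale_leq _ _)).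
  have s4 : (size (p + l * polyn c.2)%R <= N.+1)%N.
    rewrite (leq_trans (size_polyD _ _)) // geq_max sp.
    apply: (leq_trans (size_polyMleq _ _)); have := size_npoly c.2.
    move: sl jN; set a := size _; set b := size _; lia.
  by split; rewrite /reduced_pair /= ?npolypK.
have -> : [set t | (polyn t.1.1 != 0) && reduced_pair t.2 && (@unreduce N j0 t
  == (h, f))] = G @: A.
  apply/setP => -[[l2 p2] [h2 f2]]; rewrite inE /=; apply/idP/imsetP.
    move=> /andP[/andP[l20 r2] /eqP E].
    have [E1 E2] := unreduceE l2 p2 h2 f2 jN.
    rewrite E /= in E1 E2; rewrite E1 E2 in hE fE.
    have [_ [c [d [c0 sd l2E h2E [p2E f2E]]]]] := reduction_unique k2 l0 r r2
      (esym hE) (esym fE).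
    have cA : (c, NPoly sd) \in A by rewrite inE.
    exists (c, NPoly sd) => //; have [e1 e2 e3 e4 _] := GE _ cA.
    rewrite [RHS]surjective_pairing [X in (X, _)]surjective_pairing [X in (_,
      X)]surjective_pairing.
    by congr ((_, _), (_, _)); apply: val_inj; rewrite /= ?e1 ?e2 ?e3 ?e4.
  case=> c cA E; have [e1 e2 e3 e4 e5] := GE _ cA.
  rewrite -E /= in e1 e2 e3 e4 e5; have c0 : c.1 != 0 by rewrite inE in cA.
  rewrite e5 andbT e1 scaler_eq0 negb_or c0 l0 /=.
  have [E1 E2] := unreduceE l2 p2 h2 f2 jN.
  apply/eqP; rewrite [LHS]surjective_pairing; congr (_, _); apply: val_inj.
    rewrite [LHS]E1 e1 e3 /= hE -scalerAl -scalerAr scalerA divff // scale1r //.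
  rewrite [LHS]E2 e1 e2 e3 e4 /= fE.
  rewrite -!mul_polyC; set d := polyn c.2.
  have cc : c.1%:P * c.1^-1%:P = 1 by rewrite -polyCM divff.
  rewrite polyC_exp (sqrp2D k2).
  have -> : (c.1%:P * l) ^+ 2 * (c.1^-1%:P ^+ 2 * (f1 + d ^+ 2 + h1 * d)) =
    (c.1%:P * c.1^-1%:P) ^+ 2 * l ^+ 2 * (f1 + d ^+ 2 + h1 * d) by ring.
  have -> : c.1%:P * l * (c.1^-1%:P * h1) = (c.1%:P * c.1^-1%:P) * l * h1 by ring.
  rewrite cc expr1n !mul1r -[RHS]addr0 -(addpp2 k2 (l ^+ 2 * d ^+ 2 + l ^+ 2 *
    h1 * d)); ring.
(* Injectivity of [G]: as [l] is nonzero, the scalar is read off from the multiple of [l] and the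
   translation from the new [p]. *)
rewrite card_in_imset; last first.
  move=> c d cA dA E; have [e1 e2 _ _ _] := GE _ cA;
    have [e1' e2' _ _ _] := GE _ dA.
  rewrite [c]surjective_pairing [d]surjective_pairing; congr (_, _).
    have : (c.1 - d.1) *: l = 0 by rewrite scalerBl -e1 -e1' E subrr.
    by move/eqP; rewrite scaler_eq0 (negPf l0) orbF subr_eq0 => /eqP.
  apply: val_inj; apply: (mulfI l0); apply: (addrI p).
  by rewrite -[LHS]e2 -[RHS]e2' E.
have -> : A = finset.setX [set~ 0]%SET [set: {poly_(N - j0).+1 k}]%SET.
  by apply/setP => -[c d]; rewrite !inE /= andbT.
by rewrite cardsX cardsC1 cardsT card_npoly.
Qed.

(** The hypothesis isolates what is used of the product of the tau's, [ok j l] standing for the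
    nonvanishing of [l] at the points. The factor q^j / (q - 1) is the number q^(N+1) of polynomials
    [p] divided by the size of a fibre. *)
Lemma sum_reduction (R : numFieldType) N (W : nat -> {poly k} -> {poly k} -> R)
  (ok : nat -> {poly k} -> bool) :
  (forall j (l p h f : {poly k}), (j <= N)%N -> l != 0 -> (size l <= j.+1)%N ->
    (size p <= N.+1)%N ->
     reduced (N - j) h f ->
     W N (l * h) (l ^+ 2 * f + p ^+ 2 + l * h * p) = (ok j l)%:R * W (N - j)%N
       h f) ->
  \sum_(x : npair N | polyn x.1 != 0) W N (polyn x.1) (polyn x.2) =
  \sum_(j < N.+1) #|k|%:R ^+ j * (#|k|.-1)%:R^-1 *
     #|[set l : {poly_j.+1 k} | (polyn l != 0) && ok j (polyn l)]|%:R *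
     \sum_(x : npair (N - j) | reduced_pair x) W (N - j)%N (polyn x.1) (polyn x.2).
Proof.
move=> WE.
pose c j : R := ((#|k|.-1 * #|k| ^ (N - j).+1)%N)%:R.
have q_gt1 : (1 < #|k|)%N := finNzRing_gt1 k.
have c0 j : c j != 0 by rewrite pnatr_eq0 muln_eq0 negb_or expn_eq0;
  case: #|k| q_gt1 => [|[|]].
pose valid j (t : ({poly_j.+1 k} * {poly_N.+1 k}) * npair (N - j)) :=
  (polyn t.1.1 != 0) && reduced_pair t.2.
(* By [fibre_card] the terms 1 / c_j over the fibre of [x] add up to 1; afterwards the sums are
   exchanged. *)
transitivity (\sum_(x : npair N | polyn x.1 != 0) \sum_(j < N.+1)
   \sum_(t | @valid j t) (unreduce t == x)%:R / c j * W N (polyn x.1) (polyn x.2)).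
  apply: eq_bigr => x x0; have [j0 j0N fib] := fibre_card x0.
  rewrite (bigD1 (Ordinal (j0N : (j0 < N.+1)%N))) //= [X in _ + X]big1 ?addr0;
    last first.
    move=> j /eqP ne; rewrite -!mulr_suml; have := fib j (ltn_ord j).
    case: eqP => [jj|_]; first by case: ne; apply: val_inj.
    move=> /eqP; rewrite cards_eq0 => /eqP/setP E.
    rewrite big1 ?mul0r // => t vt; have := E t;
      rewrite !inE /= -/(valid _ t) vt /= => -> //.
  rewrite -!mulr_suml; have := fib j0 j0N; rewrite eqxx => E.
  have -> : \sum_(t | @valid j0 t) ((unreduce t == x)%:R : R) = c j0.
    rewrite /c -E -natr_sum; congr _%:R;
      rewrite -sum1_card big_mkcond /= [RHS]big_mkcond /=.
    by apply: eq_bigr => t _; rewrite !inE -/(valid _ t); case: ifP => // _;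
      case: eqP.
  by rewrite divff ?mul1r.
rewrite exchange_big /=; apply: eq_bigr => j _.
rewrite exchange_big /=.
transitivity (\sum_(t | @valid j t) (c j)^-1 * ((ok j (polyn t.1.1))%:R * W (N
  - j)%N (polyn t.2.1) (polyn t.2.2))).
  apply: eq_bigr => -[[l p] [h f]] /andP[/= l0 r].
  have [E1 E2] := unreduceE l p h f (ltn_ord j).
  have h0 : polyn h != 0 by case/and5P: r.
  rewrite (bigD1 (unreduce (l, p, (h, f)))) /=;
    last by rewrite [polyn _]E1 mulf_neq0.
  rewrite eqxx mul1r big1 ?addr0; last by move=> x /andP[_ /negPf];
    rewrite eq_sym => ->; rewrite !mul0r.
  rewrite [X in W N X]E1 [X in W N _ X]E2 (WE j) ?size_npoly //.
  exact: ltn_ord j.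
rewrite -big_distrr /=.
rewrite -(pair_big (fun lp : {poly_j.+1 k} * {poly_N.+1 k} => polyn lp.1 != 0)
  (@reduced_pair (N - j))
  (fun lp x => (ok j (polyn lp.1))%:R * W (N - j)%N (polyn x.1) (polyn x.2))) /=.
under eq_bigr do rewrite -big_distrr.
rewrite -mulr_suml mulrA; congr (_ * _).
have -> : \sum_(lp : {poly_j.+1 k} * {poly_N.+1 k} | polyn lp.1 != 0) ((ok j
  (polyn lp.1))%:R : R) =
   #|[set l : {poly_j.+1 k} | (polyn l != 0) && ok j (polyn l)]|%:R * #|k|%:R
     ^+ N.+1.
  transitivity (\sum_(l : {poly_j.+1 k} | polyn l != 0) \sum_(p : {poly_N.+1
    k}) ((ok j (polyn l))%:R : R)).
    by rewrite pair_big; apply: eq_bigl => x; rewrite andbT.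
  under eq_bigr do rewrite sumr_const card_npoly -[_ *+ (_ ^ _)]mulr_natr natrX.
  rewrite -mulr_suml -natr_sum; congr (_%:R * _).
  rewrite -sum1_card big_mkcond /= [RHS]big_mkcond /=; apply: eq_bigr => l _.
  by rewrite inE; case: (polyn l != 0) => //=; case: (ok _ _).
have q0 : (#|k|%:R : R) != 0 by rewrite pnatr_eq0; case: #|k| q_gt1.
have qN : (#|k|%:R : R) ^+ N.+1 = #|k|%:R ^+ j * #|k|%:R ^+ (N - j).+1.
  by rewrite -exprD addnS subnKC // -ltnS.
have p0 : ((#|k|.-1)%:R : R) != 0 by rewrite pnatr_eq0; case: #|k| q_gt1 => [|[|]].
rewrite qN /c natrM natrX; field; rewrite ?q0 ?p0 ?expf_neq0 //.
Qed.

End Fibres.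

(** * The symbol tau and Artin-Schreier equations *)

Section ClosureChar2.
Variables (k : finFieldType) (K : closedFieldType) (iota : {rmorphism k -> K}).
Hypothesis q_even : ~~ odd #|k|.

Notation F := (@Frob k K).

Lemma closure_pchar2 : 2%N \in [pchar K].
Proof. by rewrite (fmorph_pchar iota) pchar2_even. Qed.
Let K2 := closure_pchar2.

Lemma kext_add m (x y : K) : kext k m x -> kext k m y -> kext k m (x + y).
Proof.
by move=> kx ky; have [_ + _] := kext_subfield iota m => /(_ x y kx ky);
  rewrite (oppr_pchar2 K2).
Qed.

Lemma kext_div m (x y : K) : kext k m x -> kext k m y -> kext k m (x / y).
Proof. by move=> kx ky; have [_ _] := kext_subfield iota m => /(_ x y kx ky). Qed.

Lemma kext_mul m (x y : K) : kext k m x -> kext k m y -> kext k m (x * y).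
Proof.
move=> kx ky; rewrite -[y]invrK; apply: kext_div => //; rewrite -[_^-1]mul1r.
apply: kext_div => //; have [+ _ _] := kext_subfield iota m => /(_ 1).
by rewrite rmorph1.
Qed.

Lemma kext0 m : kext k m (0 : K).
Proof. by have [+ _ _] := kext_subfield iota m => /(_ 0); rewrite rmorph0. Qed.

Lemma iter_FrobD m (x y : K) : iter m F (x + y) = iter m F x + iter m F y.
Proof.
rewrite !iter_Frob; have [p pr_p pcharKp] := finPcharP k.
have pK : p \in [pchar K] by rewrite (fmorph_pchar iota).
rewrite (@exprDn_pchar K x y) //.
rewrite (eq_pnat _ (pcharf_eq pK)) (card_pprimeChar pcharKp) pnatX.
by rewrite pnatX pnat_id.
Qed.

Lemma iter_FrobM m (x y : K) : iter m F (x * y) = iter m F x * iter m F y.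
Proof. by rewrite !iter_Frob exprMn. Qed.

Lemma sqrrD2 (x y : K) : (x + y) ^+ 2 = x ^+ 2 + y ^+ 2.
Proof. by rewrite sqrrD mulr2n (addrr_pchar2 K2) addr0. Qed.

Lemma sqrf_inj2 (x y : K) : x ^+ 2 = y ^+ 2 -> x = y.
Proof.
move=> xy; apply/eqP; rewrite -subr_eq0 (oppr_pchar2 K2) -sqrf_eq0 sqrrD2 xy.
by rewrite (addrr_pchar2 K2).
Qed.

Lemma card_kext_even m : (0 < m)%N -> (#|k| ^ m = (#|k| ^ m)./2.*2)%N.
Proof.
by case: m => // m _; rewrite -[LHS]odd_double_half oddX /= (negPf q_even).
Qed.

(** The sum of the two equations factors as (z + y)(z + y + a). *)
Lemma quad_root_pair (a b y z : K) :
  y ^+ 2 + a * y + b = 0 -> z ^+ 2 + a * z + b = 0 -> z = y \/ z = y + a.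
Proof.
move=> ry rz; have : (z + y) * (z + (y + a)) = 0.
  have := congr2 +%R ry rz; rewrite addr0 => <-.
  rewrite -[LHS]addr0 -(addrr_pchar2 K2 b) -[LHS]addr0 -(addrr_pchar2 K2 (z * y)).
  rewrite -[RHS]addr0 -(addrr_pchar2 K2 (z * y)) -[RHS]addr0 -(addrr_pchar2 K2
    (z * y)); ring.
move/eqP; rewrite mulf_eq0 !addr_eq0 !(oppr_pchar2 K2) => /orP[]/eqP; tauto.
Qed.

(** For a = 0 squaring is bijective on k_m and the root is unique; otherwise y and y + a are
    distinct and lie both in k_m or both outside it. *)
Lemma tauE m (a b : K) : (0 < m)%N -> kext k m a -> kext k m b ->
  tau k m a b = if a == 0 then 0 else
    if `[< exists y, quad_roots k m a b y >] then 1 else -1.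
Proof.
move=> m0 ka kb; rewrite /tau.
have one (y : K) : #|` fset_set [set y]| = 1%N by rewrite fset_set1 cardfs1.
case: eqP => [a0|/eqP a0].
  (* This is the square root of [b], since b^(q^m) = b. *)
  suff -> : quad_roots k m a b = [set b ^+ ((#|k| ^ m)./2)]%classic by rewrite one.
  have rb : (b ^+ (#|k| ^ m)./2) ^+ 2 = b.
    by rewrite -exprM muln2 -card_kext_even // -iter_Frob kb.
  apply/seteqP; split=> y /=.
    move=> [ky]; rewrite a0 mul0r addr0 => /eqP;
      rewrite addr_eq0 (oppr_pchar2 K2) => /eqP yb.
    by apply: sqrf_inj2; rewrite yb rb.
  move=> ->; split; last by rewrite a0 mul0r addr0 rb (addrr_pchar2 K2).
  by apply: sqrf_inj2; rewrite expr2 -iter_FrobM -expr2 rb kb.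
case: asboolP => [[y [ky ry]]|nex].
  suff -> : quad_roots k m a b = [set y; y + a]%classic.
    rewrite fset_setU // !fset_set1 cardfs2.
    by rewrite -[X in X == _]addr0 (inj_eq (addrI y)) eq_sym a0.
  apply/seteqP; split=> z /=.
    by move=> [_ rz]; have [->|->] := quad_root_pair ry rz; [left|right].
  case=> -> //; split; first exact: kext_add.
  rewrite -ry sqrrD2 mulrDr -expr2.
  have := addrr_pchar2 K2 (a ^+ 2) => aa.
  by rewrite -[RHS]addr0 -aa; ring.
suff -> : quad_roots k m a b = set0 by rewrite fset_set0 cardfs0.
by apply/seteqP; split=> // y ry; case: nex; exists y.
Qed.

(** The map from y to l y + c carries the roots of one equation to those of the other. *)
Lemma tau_scale m (a b l c : K) : (0 < m)%N -> kext k m a -> kext k m b ->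
  kext k m l -> kext k m c -> l != 0 ->
  tau k m (l * a) (l ^+ 2 * b + c ^+ 2 + l * a * c) = tau k m a b.
Proof.
move=> m0 ka kb kl kc l0.
rewrite !tauE //; try by rewrite ?expr2; do ! [apply: kext_add | apply: kext_mul].
rewrite mulf_eq0 (negPf l0) /=; case: eqP => // _.
have ll : l * l^-1 = 1 by rewrite divff.
suff -> : `[< exists y, quad_roots k m (l * a) (l ^+ 2 * b + c ^+ 2 + l * a *
  c) y >] =
  `[< exists y, quad_roots k m a b y >] by [].
have key y : (l * y + c) ^+ 2 + l * a * (l * y + c) + (l ^+ 2 * b + c ^+ 2 + l
  * a * c) =
    l ^+ 2 * (y ^+ 2 + a * y + b).
  have := addrr_pchar2 K2 (c ^+ 2 + l * a * c) => Z.
  by rewrite sqrrD2 -[RHS]addr0 -Z; ring.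
apply: asbool_equiv_eq; split=> -[y [ky ry]].
  exists ((y + c) / l); split; first by apply: kext_div => //; apply: kext_add.
  have E : l * ((y + c) / l) + c = y.
    by rewrite mulrCA ll mulr1 -addrA (addrr_pchar2 K2) addr0.
  by apply: (mulfI (expf_neq0 2 l0)); rewrite mulr0 -key E.
exists (l * y + c); split; first by apply: kext_add => //; apply: kext_mul.
by rewrite key ry mulr0.
Qed.

Lemma tau0 m (b : K) : (0 < m)%N -> kext k m b -> tau k m 0 b = 0.
Proof. by move=> m0 kb; rewrite tauE ?eqxx //; exact: kext0. Qed.

Lemma tau_sqr m (a b : K) : (0 < m)%N -> kext k m a -> kext k m b ->
  tau k m a b ^+ 2 = (a != 0)%:R.
Proof.
move=> m0 ka kb; rewrite tauE //; case: eqP => _ /=; first by rewrite expr0n.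
by case: ifP; rewrite ?sqrrN expr1n.
Qed.

(* The constant [y ^+ 2 + a * y], for [y] with [F^m y = y + a], interchanges the
   split and the nonsplit equations. *)
Lemma tau_flip m (a : K) : (0 < m)%N -> kext k m a ->
  exists2 c, kext k m c & forall b, kext k m b -> tau k m a (b + c) = - tau k m a b.
Proof.
move=> m0 ka; have [a0|a0] := eqVneq a 0.
  by exists 0; [exact: kext0 | move=> b kb; rewrite addr0 a0 tau0 ?oppr0].
have q1 : (1 < #|k| ^ m)%N by rewrite -(exp1n m) ltn_exp2r// finNzRing_gt1.
have [y yE] : exists y, iter m F y = y + a.
  have [y yE] := solve_monicpoly (fun i => if i == 0%N then a else (i ==
    1%N)%:R) (ltnW q1).
  exists y; rewrite iter_Frob yE -(big_mkord xpredT (fun i => (if i == 0%N then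
    a else (i == 1%N)%:R) * y ^+ i)).
  rewrite big_ltn ?(ltnW q1) // big_ltn //= big_nat_cond big1.
    by rewrite mulr1 expr1 mul1r addr0 addrC.
  by move=> [|[|i]] // _; rewrite mul0r.
have kc : kext k m (y ^+ 2 + a * y).
  rewrite /kext /= iter_FrobD expr2 !iter_FrobM ka yE.
  have := addrr_pchar2 K2 (a * y + a ^+ 2) => Z.
  by rewrite -[RHS]addr0 -Z; ring.
exists (y ^+ 2 + a * y) => // b kb; rewrite !tauE //; last exact: kext_add.
rewrite (negPf a0).
have key z : (z + y) ^+ 2 + a * (z + y) + (b + (y ^+ 2 + a * y)) = z ^+ 2 + a *
  z + b.
  have := addrr_pchar2 K2 (a * y + y ^+ 2) => Z.
  by rewrite sqrrD2 -[RHS]addr0 -Z; ring.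
have Fneq z : iter m F z = z + a -> ~ kext k m z.
  by rewrite /kext /= => -> /eqP; rewrite -subr_eq0 addrAC subrr add0r (negPf a0).
case: asboolP => [[w [kw rw]]|nex1]; case: asboolP => [[z [kz rz]]|nex2];
  rewrite ?opprK //.
  (* If both equations split, [w] is z + y or z + y + a, and F^m moves it by [a]. *)
  case: (@Fneq w) => //.
  have -> : w = z + y \/ w = z + y + a -> iter m F w = w + a.
    by case=> ->; rewrite !iter_FrobD kz yE ?ka addrA.
  by [].
  by apply: (quad_root_pair (a := a) (b := b + (y ^+ 2 + a * y))); rewrite ?key.
(* If neither splits, a root [z] in [K] of the equation with constant term [b] satisfies F^m z = z +
   a, and then F^m fixes z + y. *)
have [z rz] : exists z, z ^+ 2 + a * z + b = 0.
  have [z zE] := solve_monicpoly (fun i => if i == 0%N then - b else - a) (isT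
    : (0 < 2)%N).
  exists z; rewrite zE !big_ord_recl big_ord0 /= expr0 expr1.
  ring.
case: nex1; exists (z + y); split; last by rewrite key.
have rFz : (iter m F z) ^+ 2 + a * iter m F z + b = 0.
  rewrite expr2 -iter_FrobM -{1}ka -iter_FrobM -{1}kb -!iter_FrobD -expr2 rz.
  exact: kext0.
rewrite /kext /= iter_FrobD yE.
have [zz|->] := quad_root_pair rz rFz; first by case: nex2; exists z.
by rewrite addrACA -[X in _ = X]addr0 -(addrr_pchar2 K2 a); ring.
Qed.

End ClosureChar2.

(** Subtracting one of its elements maps a nonempty fibre of [phi] in [A] injectively into the
    kernel. *)
Lemma card_le_image_kernel (V : finZmodType) (W : zmodType) (phi : V -> W)
    (A : {set V}) (s : seq W) :
  {morph phi : x y / x - y} -> {in A &, forall x y, x - y \in A} ->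
  (#|[set x in A | phi x \in s]| <= size s * #|[set x in A | phi x == 0%R]|)%N.
Proof.
move=> phiB AB; elim: s => [|c s IH].
  by rewrite mul0n leqn0 cards_eq0; apply/eqP/setP => x; rewrite !inE andbF.
have -> : [set x in A | phi x \in c :: s] =
    [set x in A | phi x == c] :|: [set x in A | phi x \in s].
  by apply/setP => x; rewrite !inE andb_orr.
rewrite (leq_trans (leq_card_setU _ _)) // mulSn leq_add //.
have [->|[x0]] := set_0Vmem [set x in A | phi x == c]; first by rewrite cards0.
rewrite inE => /andP[x0A /eqP x0c].
rewrite -(card_imset _ (subIr x0)); apply: subset_leq_card.
apply/fintype.subsetP => _ /imsetP[x + ->]; rewrite !inE => /andP[xA /eqP xc].
by rewrite AB //= phiB xc x0c subrr.
Qed.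

(** * Evaluation at the points alpha_i and polynomials vanishing at some of them *)

Section Evaluation.
Variables (k : finFieldType) (K : closedFieldType) (iota : {rmorphism k -> K}).

Notation F := (@Frob k K).
Notation ev := (evalP1 iota).
Implicit Types p : {poly k}.

Lemma evalP1D N p1 p2 x : ev N (p1 + p2) x = ev N p1 x + ev N p2 x.
Proof. by case: x => [b|] /=; rewrite ?rmorphD ?hornerD ?coefD ?rmorphD. Qed.

Lemma evalP1B N p1 p2 x : ev N (p1 - p2) x = ev N p1 x - ev N p2 x.
Proof. by case: x => [b|] /=; rewrite ?rmorphB ?hornerD ?hornerN ?coefB
  ?rmorphB. Qed.

Lemma evalP1_0 N x : ev N 0 x = 0.
Proof. by rewrite -[X in ev N X x](subrr 0) evalP1B subrr. Qed.

Lemma evalP1M N1 N2 p1 p2 x : (size p1 <= N1.+1)%N -> (size p2 <= N2.+1)%N ->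
  ev (N1 + N2) (p1 * p2) x = ev N1 p1 x * ev N2 p2 x.
Proof.
case: x => [b|] s1 s2 /=; first by rewrite rmorphM hornerM.
by rewrite coefM_top // rmorphM.
Qed.

Lemma horner_iter_Frob s p (b : K) :
  iter s F (map_poly iota p).[b] = (map_poly iota p).[iter s F b].
Proof.
elim/poly_ind: p => [|p c IH].
  rewrite rmorph0 !horner0; exact: (kext0 iota).
rewrite rmorphD rmorphM /= map_polyX map_polyC /= !hornerMXaddC.
rewrite (iter_FrobD iota) iter_FrobM IH.
by have [+ _ _] := kext_subfield iota s => /(_ c) ->.
Qed.

Lemma evalP1_kext n N p x : P1ext k n x -> kext k n (ev N p x).
Proof.
case=> [[b kb <-]|->]; first by rewrite /kext /= horner_iter_Frob kb.
by have [+ _ _] := kext_subfield iota n => /(_ p`_N).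
Qed.

Section Points.
Variables (m : nat) (n : 'I_m -> nat) (a : {ffun 'I_m -> option K}).
Hypothesis n_ge1 : forall i, (1 <= n i)%N.
Hypothesis aA : An k K n a.

Notation deg S := (\sum_(i in S : {set 'I_m}) n i)%N.

(** As the value at infinity is the coefficient of x^N, these are the global sections of O(N) on P^1
    that vanish at the points of [S]. *)
Definition kerS N (S : {set 'I_m}) : {set {poly_N.+1 k}} :=
  [set l | [forall i in S, ev N (polyn l) (a i) == 0]].

Lemma iter_FrobP1 s (x : option K) : iter s (@FrobP1 k K) x = omap (iter s F) x.
Proof. by case: x => [b|]; elim: s => //= s ->. Qed.

(** Applying F^(n_j - t) shows that F^(n_j - t + s) maps alpha_i to alpha_j. So i = j, and n_i
    divides n_i - t + s, which lies strictly between 0 and 2 n_i; hence s = t. *)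
Lemma conj_inj i j b c s t : a i = Some b -> a j = Some c -> (s < n i)%N -> (t
  < n j)%N ->
  iter s F b = iter t F c -> (i, s) = (j, t).
Proof.
have [P1 dist] := aA; move=> ai aj si tj E.
have kc : iter (n j) F c = c by move: (P1 j); rewrite aj => -[[d kd [<-]]|].
have [] := dist i j (n j - t + s)%N.
  by rewrite iter_FrobP1 ai aj /= iterD E -iterD subnK ?kc // ltnW.
move=> /dvdnP[e eE] ij; rewrite -ij in tj eE *; congr (_, _).
case: e eE => [|[|e]] eE; last 1 first.
- have : (2 * n i <= n i - t + s)%N by rewrite eE leq_mul2r ltnS orbT.
  by move: si tj; clear; lia.
- by move: eE si tj; clear; lia.
- by move: eE si tj; clear; lia.
Qed.

Lemma infty_unique i j : a i = None -> a j = None -> i = j.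
Proof.
have [_ dist] := aA; move=> ai aj.
by have [] := dist i j 0%N; rewrite /= ?ai ?aj.
Qed.

Lemma infty_deg i : a i = None -> n i = 1%N.
Proof.
have [_ dist] := aA; move=> ai; have [] := dist i i 1%N; rewrite /= ?ai //.
by rewrite dvdn1 => /eqP.
Qed.

Let affine (S : {set 'I_m}) := [set i in S | a i].

(** All conjugates of the finite points of [S] are roots, distinct by [conj_inj], and too many for a
    nonzero polynomial of this size. *)
Lemma vanish_affine S p : (size p <= deg (affine S))%N ->
  (forall i, i \in S -> a i -> forall N, ev N p (a i) = 0) -> p = 0.
Proof.
move=> sp van; apply/eqP/negPn/negP => p0.
pose rs := [seq iter s F (odflt 0 (a i)) | i <- enum (affine S), s <- seq.iota
  0 (n i)].
have size_rs : size rs = deg (affine S).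
  rewrite size_allpairs_dep sumnE big_map big_enum /=.
  by apply: eq_bigr => i _; rewrite size_iota.
have uniq_rs : uniq rs.
  apply: allpairs_uniq_dep; first exact: enum_uniq.
    by move=> i _; rewrite iota_uniq.
  move=> _ _ /allpairsPdep[i [s [+ + ->]]] /allpairsPdep[j [t [+ + ->]]] /=.
  rewrite !mem_enum !inE !mem_iota !add0n /=.
  case ai: (a i) => [b|]; rewrite ?andbF // => _ si.
  case aj: (a j) => [c|]; rewrite ?andbF // => _ tj /= E.
  by have [-> ->] := conj_inj ai aj si tj E.
have all_rs : all (root (map_poly iota p)) rs.
  apply/allP => _ /allpairsPdep[i [s [+ _ ->]]];
    rewrite mem_enum inE => /andP[iS ai].
  have := van i iS ai 0%N; case: (a i) ai => // b _ /= pb.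
  rewrite rootE -horner_iter_Frob pb; apply/eqP; exact: (kext0 iota).
have := max_poly_roots _ all_rs uniq_rs; rewrite map_poly_eq0 => /(_ p0).
by rewrite size_map_poly size_rs ltnNge sp.
Qed.

(** The point at infinity is fixed by F, so it occurs at most once and contributes 1. *)
Lemma deg_affine S : (deg S <= (deg (affine S)).+1)%N /\
  ((deg S <= deg (affine S))%N \/ exists2 i, i \in S & a i = None).
Proof.
have [[i iS ai]|no] := pselect (exists2 i, i \in S & a i = None); last first.
  suff -> : affine S = S by split; [exact: leqnSn|left].
  apply/setP => i; rewrite inE; case iS: (i \in S) => //=.
  by case ai: (a i) => //; case: no; exists i.
split; last by right; exists i.
rewrite (bigD1 i) //= (infty_deg ai) add1n ltnS.
rewrite (eq_bigl (fun j => j \in affine S)) // => j; rewrite inE;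
  case jS: (j \in S) => //=.
case aj: (a j) => [b|]; last by rewrite (infty_unique ai aj) eqxx.
by apply/eqP => ji; move: aj; rewrite ji ai.
Qed.

(* These coefficients, together with the value at infinity if that point occurs
   in [S], bound the degree of [p] below the number of its finite zeros. *)
Lemma vanish_eq0 N (S : {set 'I_m}) p : (size p <= N.+1)%N ->
  (forall i, i \in S -> ev N p (a i) = 0) ->
  (forall i, (i < N.+1 - deg S)%N -> p`_(deg (affine S) + i) = 0) -> p = 0.
Proof.
move=> sp van top; apply: (@vanish_affine S) => [|i iS ai M]; last first.
  by have := van i iS; case: (a i) ai.
have [d1 d2] := deg_affine S.
apply/leq_sizeP => j sj.
have [jN|Nj] := ltnP N j; first by rewrite nth_default // (leq_trans sp).
rewrite -(subnKC sj); case: (ltnP (j - deg (affine S)) (N.+1 - deg S)) => jj;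
  first exact: top.
rewrite subnKC //; case: d2 => [d2|[i iS ai]].
  by move: jj Nj sj d2; clear; lia.
have jN : j = N by move: jj Nj sj d1; clear; lia.
by have := van i iS; rewrite ai /= jN => /eqP; rewrite fmorph_eq0 => /eqP.
Qed.

Lemma kerS_subr N S : {in kerS N S &, forall x y, x - y \in kerS N S}.
Proof.
move=> x y; rewrite !inE => /forall_inP vx /forall_inP vy; apply/forall_inP => i iS.
by rewrite raddfB /= evalP1B (eqP (vx i iS)) (eqP (vy i iS)) subrr.
Qed.

(** By [vanish_eq0], the N + 1 - deg S coefficients kept by [phi] determine an element of the
    kernel. *)
Lemma card_kerS_le N S : (#|kerS N S| <= #|k| ^ (N.+1 - deg S))%N.
Proof.
pose d := (N.+1 - deg S)%N.
pose phi (l : {poly_N.+1 k}) : {poly_d k} := mk_npoly d (fun i => (polyn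
  l)`_(deg (affine S) + i)).
rewrite -card_npoly -(@card_in_imset _ _ phi); first exact: max_card.
move=> x y xS yS E; apply/eqP; rewrite -subr_eq0; apply/eqP; apply: val_inj.
have := kerS_subr xS yS; rewrite inE => /forall_inP van.
apply: (@vanish_eq0 N S) => [|i iS|i id]; first exact: size_npoly.
  exact/eqP/van.
have /(congr1 (fun l : {poly_d k} => (polyn l)`_i)) := E.
by rewrite /= !coef_poly id coefB => ->; rewrite subrr.
Qed.

Definition kextseq j : seq K := fset_set (kext k j).

Lemma mem_kextseq j x : (0 < j)%N -> (x \in kextseq j) = `[< kext k j x >].
Proof.
move=> j0; have [fin _] := kext_card iota j0.
by apply/idP/asboolP; rewrite /kextseq in_fset_set // inE.
Qed.

Lemma size_kextseq j : (0 < j)%N -> size (kextseq j) = (#|k| ^ j)%N.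
Proof. by move=> j0; have [_ <-] := kext_card iota j0. Qed.

Lemma kerS_setU1 N S i : [set x in kerS N S | ev N (polyn x) (a i) == 0] = kerS
  N (i |: S).
Proof.
apply/setP => x; rewrite !inE; apply/andP/forall_inP => [[/forall_inP v vi] j|v].
  by rewrite !inE => /predU1P[->//|]; exact: v.
by split; [apply/forall_inP => j jS; apply: v|apply: v];
  rewrite !inE ?jS ?orbT ?eqxx.
Qed.

(** Each condition costs at most a factor q^(n_i), since the values at alpha_i lie in k_(n_i). *)
Lemma card_kerS_ge N S : (#|k| ^ N.+1 <= #|k| ^ deg S * #|kerS N S|)%N.
Proof.
have [c] := ubnP #|S|; elim: c S => // c IH S /ltnSE Sc.
have [->|[i iS]] := set_0Vmem S.
  rewrite big_set0 mul1n -card_npoly; apply: subset_leq_card;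
    apply/fintype.subsetP => x _.
  by rewrite inE; apply/forall_inP => i; rewrite inE.
have Sc' : (#|S :\ i| < c)%N by move: Sc; rewrite (cardsD1 i) iS.
apply: (leq_trans (IH _ Sc')); rewrite (big_setD1 i iS) /= expnD [X in (_ <=
  X)%N]mulnAC [X in (_ <= X)%N]mulnC leq_mul2l.
rewrite -(size_kextseq (n_ge1 i)) mulnC.
have [P1 _] := aA.
have := @card_le_image_kernel _ _ (fun x : {poly_N.+1 k} => ev N (polyn x) (a
  i)) (kerS N (S :\ i)) (kextseq (n i)).
rewrite kerS_setU1 finset.setD1K // mulnC => le; apply/orP; right;
  apply: leq_trans (le _ _).
- apply: subset_leq_card; apply/fintype.subsetP => x xS;
  rewrite !inE -/(kerS N _) mem_kextseq //.
  rewrite inE in xS; rewrite xS; apply/asboolP; exact: evalP1_kext.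
- by move=> x y; rewrite raddfB /= evalP1B.
- exact: kerS_subr.
Qed.

Lemma card_kerS N S : #|kerS N S| = (#|k| ^ (N.+1 - deg S))%N.
Proof.
have q1 := finNzRing_gt1 k.
apply/eqP; rewrite eqn_leq card_kerS_le /=.
case: (leqP (deg S) N.+1) => dS; last first.
  (* Here the truncated exponent is 0, and the zero polynomial alone gives the lower bound. *)
  rewrite (eqP (ltnW dS : N.+1 - deg S == 0)%N) expn0 card_gt0; apply/set0Pn;
    exists 0.
  by rewrite inE; apply/forall_inP => i _; rewrite /= evalP1_0.
by have := card_kerS_ge N S; rewrite -{1}(subnKC dS) expnD leq_mul2l expn_eq0;
  case: #|k| q1.
Qed.

(** Were [c] not attained, the polynomials vanishing at the other points would take at most q^(n_i)
    - 1 values at alpha_i, against the ratio q^(n_i) of the kernels in [card_kerS]. *)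
Lemma evalP1_surj N i c : (deg [set: 'I_m]%SET <= N.+1)%N -> kext k (n i) c ->
  exists2 p : {poly k}, (size p <= N.+1)%N &
    forall j, ev N p (a j) = if j == i then c else 0.
Proof.
move=> dN kc; have q1 := finNzRing_gt1 k.
have [[x xS xc]|no] := pselect (exists2 x, x \in kerS N (~: [set i]) & ev N
  (polyn x) (a i) = c).
  exists (polyn x) => [|j]; first exact: size_npoly.
  case: eqP => [->//|/eqP ji]; move: xS; rewrite inE => /forall_inP v; apply/eqP/v.
  by rewrite !inE.
have := @card_le_image_kernel _ _ (fun x : {poly_N.+1 k} => ev N (polyn x) (a
  i)) (kerS N (~: [set i])) (rem c (kextseq (n i))).
rewrite kerS_setU1 finset.setUCr => /(_ _ (@kerS_subr _ _)).
have [P1 _] := aA.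
have -> : [set x in kerS N (~: [set i]) | ev N (polyn x) (a i) \in rem c
  (kextseq (n i))] = kerS N (~: [set i]).
  apply/setP => x; rewrite inE andbC; case xS: (x \in _); rewrite ?andbF // andbT.
  rewrite mem_rem_uniq ?fset_uniq // inE mem_kextseq //.
  apply/andP; split; first by apply/eqP => xc; case: no; exists x.
  by apply/asboolP; exact: evalP1_kext.
rewrite size_rem; last by rewrite mem_kextseq //; apply/asboolP.
rewrite size_kextseq // !card_kerS => le.
have {le} /le : {morph (fun x : {poly_N.+1 k} => ev N (polyn x) (a i)) : x y /
  x - y}.
  by move=> x y; rewrite raddfB /= evalP1B.
rewrite leqNgt => /negP[].
have dE : deg [set: 'I_m]%SET = (n i + deg (~: [set i]))%N.
  by rewrite (bigD1 i) ?inE //=; congr (_ + _)%N; apply: eq_bigl => j; rewrite !inE.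
have -> : (N.+1 - deg (~: [set i]) = n i + (N.+1 - deg [set: 'I_m]%SET))%N.
  by move: dE dN; clear; lia.
rewrite expnD ltn_mul2r expn_gt0 (ltnW q1) /= prednK // expn_gt0 (ltnW q1) //.
Qed.

End Points.
End Evaluation.

(** * The coefficients [bhat] as sums over subsets *)

Lemma sum_geometric_from (R : comRingType) (q : R) d N :
  \sum_(0 <= j < N | (d <= j)%N) (q - 1) * q ^+ (j - d) = q ^+ (N - d) - 1.
Proof.
elim: N => [|N IH]; first by rewrite big_geq // sub0n subrr.
rewrite big_mkcond big_nat_recr //= -big_mkcond IH; case: leqP => dN.
  by rewrite subSn // exprS; ring.
by rewrite addr0 (eqP (ltnW dN : N - d == 0)%N) (eqP (dN : N.+1 - d == 0)%N).
Qed.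

Lemma sum_signed_subsets (R : comRingType) m : (0 < m)%N ->
  \sum_(S : {set 'I_m}) (-1) ^+ #|S| = 0 :> R.
Proof.
move=> m0; transitivity (\prod_(i < m) (-1 + 1 : R)).
  rewrite bigA_distr; apply: eq_bigr => S _.
  by rewrite -prodr_const big_mkcond.
by rewrite (bigD1 (Ordinal m0)) //= addrC subrr mul0r.
Qed.

Section BCoef.
Variables (k : finFieldType) (m : nat) (n : 'I_m -> nat).
Hypothesis n_ge1 : forall i, (1 <= n i)%N.
Notation deg S := (\sum_(i in S : {set 'I_m}) n i)%N.
Notation q := (#|k|%:R : rat).

(** The leading q^j is the term of the empty set. As all n_i are positive, |S| is at most deg S, so
    the cardinalities up to j cover all these subsets. *)
Lemma bcoefE j : bcoef k n j = \sum_(S : {set 'I_m} | (deg S <= j)%N) (-1) ^+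
  #|S| * q ^+ (j - deg S).
Proof.
have card_deg (S : {set 'I_m}) : (#|S| <= deg S)%N.
  by rewrite -sum1_card; apply: leq_sum.
rewrite (partition_big (fun S : {set 'I_m} => inord #|S| : 'I_j.+1) xpredT) //=.
transitivity (\sum_(0 <= i < j.+1) (-1) ^+ i *
    \sum_(S : {set 'I_m} | (#|S| == i) && (deg S <= j)%N) q ^+ (j - deg S)).
  rewrite big_ltn //= mul1r (big_pred1 (finset.set0 : {set 'I_m})) => [|S].
    by rewrite big_set0 subn0.
  rewrite cards_eq0 /=; have [->|nz] := eqVneq S finset.set0;
    first by rewrite big_set0.
  by [].
rewrite big_mkord; apply: eq_bigr => i _; rewrite big_distrr /=.
apply: eq_big => [S|S /andP[/eqP -> _]//].
rewrite andbC; case Sj: (deg S <= j)%N => //=.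
by rewrite -val_eqE /= inordK // ltnS (leq_trans (card_deg S)).
Qed.

(** Each geometric sum gives q^(N+1-deg S) - 1, which is 0 for deg S > N by truncation, and the
    constants cancel by [sum_signed_subsets]. The exponents are now those of [card_kerS]. *)
Lemma bhatE N : (0 < m)%N -> (q - 1) * bhat k n N =
  \sum_(S : {set 'I_m}) (-1) ^+ #|S| * q ^+ (N.+1 - deg S).
Proof.
move=> m0; rewrite /bhat; under eq_bigr do rewrite bcoefE big_mkcond.
rewrite exchange_big big_distrr /=.
transitivity (\sum_(S : {set 'I_m}) (-1) ^+ #|S| * (q ^+ (N.+1 - deg S) - 1)).
  apply: eq_bigr => S _; rewrite -big_mkcond /= -sum_geometric_from !big_distrr /=.
  by apply: eq_bigr => j _; rewrite mulrCA.
rewrite -[RHS]subr0 -[X in _ = _ - X](@sum_signed_subsets rat m m0) -sumrB.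
by apply: eq_bigr => S _; rewrite mulrBr mulr1.
Qed.
End BCoef.

(** * Sums of the product of the tau's for a fixed tuple of points *)

Section Weights.
Variables (k : finFieldType) (K : closedFieldType) (iota : {rmorphism k -> K}).
Hypothesis q_even : ~~ odd #|k|.
Variables (m : nat) (n r : 'I_m -> nat) (a : {ffun 'I_m -> option K}).
Hypothesis m_gt0 : (0 < m)%N.
Hypothesis n_ge1 : forall i, (1 <= n i)%N.
Hypothesis r_gt0 : forall i, (0 < r i)%N.
Hypothesis aA : An k K n a.

Notation ev := (evalP1 iota).
Notation q := (#|k|%:R : rat).
Implicit Types h f l p : {poly k}.

(** At infinity this asks for a nonzero coefficient of x^N, so it depends on [N] as well as on
    [p]. *)
Definition nonvanishing N p : bool := [forall i, ev N p (a i) != 0].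

Definition weight N h f : rat :=
  \prod_(i < m) tau k (n i) (ev N h (a i)) (ev (2 * N) f (a i)) ^+ r i.

Lemma nonvanishing_neq0 N p : nonvanishing N p -> p != 0.
Proof.
move=> /forallP /(_ (Ordinal m_gt0)); apply: contraNneq => ->.
by rewrite evalP1_0.
Qed.

(** The indicator of nonvanishing is the product of the factors 1 - [l(alpha_i) = 0]. Expanding it
    over subsets and counting with [card_kerS] gives the sum in [bhatE], also if infinity is among
    the points. *)
Lemma card_nonvanishing N :
  #|[set l : {poly_N.+1 k} | (polyn l != 0) && nonvanishing N (polyn l)]|%:R =
    (q - 1) * bhat k n N.
Proof.
rewrite bhatE //.
transitivity (\sum_(l : {poly_N.+1 k}) \prod_(i < m) (- (ev N (polyn l) (a i)
  == 0)%:R + 1 : rat)).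
  rewrite -sum1_card natr_sum big_mkcond; apply: eq_bigr => l _ /=; rewrite inE.
  have -> : (polyn l != 0) && nonvanishing N (polyn l) = nonvanishing N (polyn l).
    by rewrite andbC; case nv: nonvanishing => //=; exact: nonvanishing_neq0 nv.
  case: ifPn => [/forallP nv|/forallPn[i]].
    by rewrite big1 // => i _; rewrite (negPf (nv i)) oppr0 add0r.
  by rewrite negbK => vi; rewrite (bigD1 i) //= vi addrC subrr mul0r.
under eq_bigr do rewrite bigA_distr.
rewrite exchange_big /=; apply: eq_bigr => S _.
rewrite -natrX -(card_kerS iota n_ge1 aA N S) -sum1_card natr_sum big_distrr /=.
rewrite [RHS]big_mkcond /=; apply: eq_bigr => l _; rewrite inE.
rewrite -big_mkcond /=; case: ifPn => [/forall_inP v|/forall_inPn[i iS /negPf v]].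
  by rewrite mulr1 -prodr_const; apply: eq_bigr => i iS; rewrite v.
by rewrite (bigD1 i) //= v oppr0 mul0r.
Qed.

(** Evaluation is multiplicative for the bounds j and N - j, so at each point the reduction becomes
    the substitution of [tau_scale]. At a zero of [l] tau is 0, and its power stays 0 because r_i >
    0. *)
Lemma weight_reduction j N l p h f : (j <= N)%N -> l != 0 -> (size l <= j.+1)%N ->
  (size p <= N.+1)%N -> reduced (N - j) h f ->
  weight N (l * h) (l ^+ 2 * f + p ^+ 2 + l * h * p) = (nonvanishing j l)%:R *
    weight (N - j) h f.
Proof.
move=> jN l0 sl sp /and5P[_ sh sf _ _].
have [P1 _] := aA.
have evh i : ev N (l * h) (a i) = ev j l (a i) * ev (N - j) h (a i).
  by rewrite -[X in ev X (l * h)](subnKC jN) evalP1M.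
have slh : (size (l * h)%R <= N.+1)%N.
  apply: (leq_trans (size_polyMleq _ _)).
  by move: sl sh jN; clear; set x := size _; set y := size _; lia.
have evf i : ev (2 * N) (l ^+ 2 * f + p ^+ 2 + l * h * p) (a i) =
    ev j l (a i) ^+ 2 * ev (2 * (N - j)) f (a i) + ev N p (a i) ^+ 2 +
    ev j l (a i) * ev (N - j) h (a i) * ev N p (a i).
  rewrite !evalP1D; congr (_ + _ + _); last 2 first.
  - by rewrite mul2n -addnn expr2 evalP1M.
  - by rewrite mul2n -addnn evalP1M // evh.
  have -> : (2 * N = (j + j) + 2 * (N - j))%N by move: jN; clear; lia.
  rewrite evalP1M //; first by rewrite expr2 evalP1M.
  by rewrite expr2; apply: (leq_trans (size_polyMleq _ _)); move: sl; clear;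
    set x := size _; lia.
rewrite /weight; case nv: (nonvanishing j l).
  rewrite mul1r; apply: eq_bigr => i _; rewrite evh evf tau_scale //;
    try exact: evalP1_kext.
  exact: (forallP nv).
rewrite mul0r; move/negbT: nv => /forallPn[i]; rewrite negbK => /eqP vi.
rewrite (bigD1 i) //= evh vi mul0r (tau0 iota q_even) //; last exact: evalP1_kext.
by rewrite expr0n eqn0Ngt r_gt0 mul0r.
Qed.

Lemma weighted_sum_reduction N :
  \sum_(x : npair k N | polyn x.1 != 0) weight N (polyn x.1) (polyn x.2) =
  \sum_(j < N.+1) q ^+ j * bhat k n j *
     \sum_(x : npair k (N - j) | reduced_pair x) weight (N - j) (polyn x.1)
       (polyn x.2).
Proof.
rewrite (sum_reduction q_even (ok := nonvanishing)); last by move=> *;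
  apply: weight_reduction.
apply: eq_bigr => j _; congr (_ * _); rewrite card_nonvanishing.
have q1 := finNzRing_gt1 k; rewrite -subn1 natrB ?(ltnW q1) //.
rewrite -mulrA mulKf // subr_eq0 eqr_nat; by case: #|k| q1 => [|[|]].
Qed.

(** The square of tau is the indicator of h(alpha_i) being nonzero, so [f] is free and contributes
    q^(2N+1). *)
Lemma sum_weight_sqr N : (forall i, r i = 2%N) ->
  \sum_(x : npair k N | polyn x.1 != 0) weight N (polyn x.1) (polyn x.2) =
  (q - 1) * bhat k n N * q ^+ (2 * N).+1.
Proof.
move=> r2; have [P1 _] := aA; rewrite -card_nonvanishing.
transitivity (\sum_(h : {poly_N.+1 k} | polyn h != 0) \sum_(f : {poly_(2 *
  N).+1 k}) ((nonvanishing N (polyn h))%:R : rat)).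
  rewrite pair_big; apply: eq_big => [x|[h f] _] /=; first by rewrite andbT.
  rewrite /weight; under eq_bigr => i _.
    rewrite r2 (tau_sqr iota q_even (n_ge1 i) (evalP1_kext iota _ _ (P1 i))
      (evalP1_kext iota _ _ (P1 i))).
    over.
  case: (boolP (nonvanishing _ _)) => [/forallP nv|/forallPn[i]].
    by rewrite big1 // => i _; rewrite nv.
  by rewrite negbK => /eqP vi; rewrite (bigD1 i) //= vi eqxx mul0r.
under eq_bigr do rewrite sumr_const card_npoly -[_ *+ (_ ^ _)]mulr_natr natrX.
rewrite -mulr_suml -natr_sum; congr (_%:R * _).
rewrite -sum1_card big_mkcond /= [RHS]big_mkcond /=; apply: eq_bigr => l _.
by rewrite inE; case: (polyn l != 0) => //=; case: (nonvanishing _ _).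
Qed.

Lemma sum_weight_odd N i0 : r i0 = 1%N -> (\sum_i n i <= (2 * N).+1)%N ->
  \sum_(x : npair k N | polyn x.1 != 0) weight N (polyn x.1) (polyn x.2) = 0.
Proof.
move=> r1 dN; have [P1 _] := aA.
transitivity (\sum_(h : {poly_N.+1 k} | polyn h != 0) \sum_(f : {poly_(2 *
  N).+1 k}) weight N (polyn h) (polyn f)).
  by rewrite pair_big; apply: eq_big => [x|[h f] _] //=; rewrite andbT.
apply: big1 => h _.
have [c kc flip] := tau_flip iota q_even (n_ge1 i0) (evalP1_kext iota N (polyn
  h) (P1 i0)).
have dN' : (\sum_(i in [set: 'I_m]%SET) n i <= (2 * N).+1)%N.
  by rewrite (eq_bigl xpredT) // => i; rewrite inE.
(* The degree bound for [f] is 2N, whence the bound 2N + 1 on |n|. *)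
have [p sp pE] := evalP1_surj iota n_ge1 aA dN' kc.
pose f0 : {poly_(2 * N).+1 k} := NPoly sp.
have : \sum_(f : {poly_(2 * N).+1 k}) weight N (polyn h) (polyn f) =
   - \sum_(f : {poly_(2 * N).+1 k}) weight N (polyn h) (polyn f).
  (* Translation by [f0] changes the sign of the factor at [i0], whose exponent is 1, and fixes the
     others. *)
  rewrite {1}(reindex_inj (addIr f0)) /= -sumrN; apply: eq_bigr => f _.
  rewrite /weight (bigD1 i0) //= [in RHS](bigD1 i0) //= -mulNr; congr (_ * _).
    by rewrite r1 !expr1 evalP1D pE eqxx flip //; exact: evalP1_kext.
  by apply: eq_bigr => i /negPf ne; rewrite evalP1D pE ne addr0.
by move/eqP; rewrite -subr_eq0 opprK -mulr2n mulrn_eq0 => /eqP.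
Qed.

End Weights.

(** * The sets P_g in terms of [reduced] *)

Lemma size_gt_coef (R : nzRingType) (p : {poly R}) i : p`_i != 0 -> (i < size p)%N.
Proof. by move=> pi; rewrite ltnNge; apply: contra pi => /(nth_default 0) ->. Qed.

Lemma dvdXp (R : fieldType) (p : {poly R}) : ('X %| p) = (p`_0 == 0).
Proof. by rewrite -['X]subr0 -polyC0 dvdp_XsubCl rootE horner_coef0. Qed.

(** Divisibility by t at infinity is the vanishing of two constant terms, which are expressions in
    the top coefficients of [h] and [f]. Its failure also forces the lower bound 2g + 1 on the
    degrees. *)
Lemma reduced_Pg (k : finFieldType) M (h f : {poly k}) :
  reduced M h f <-> Pg k (M%:Z - 1) (h, f).
Proof.
have absM : absz (M%:Z - 1 + 1) = M by rewrite subrK.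
have abs2M : absz (2 * (M%:Z - 1) + 2) = (2 * M)%N.
  by rewrite (_ : 2 * (M%:Z - 1) + 2 = (2 * M)%N%:Z) //; lia.
have size_h : h != 0 -> (0 < size h)%N by rewrite lt0n size_poly_eq0.
have const : M = 0%N -> h != 0 -> (size h <= 1)%N -> h`_M != 0.
  move=> -> h0 sh; have /size_poly1P[c c0 ->] : size h == 1%N by rewrite
    eqn_leq sh size_h.
  by rewrite coefC.
rewrite /Pg /= absM abs2M.
(* For [M = 0] the reversed polynomials are constants with zero derivatives, so only the coefficient
   of [h] is tested. *)
have -> : ('X %| gcdp (revpoly M h) (ramif (revpoly M h) (revpoly (2 * M) f))) =
  (h`_M == 0) && ((M == 0%N) || (f`_(2 * M).-1 ^+ 2 + f`_(2 * M) * h`_M.-1 ^+ 2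
    == 0)).
  rewrite dvdp_gcd !dvdXp coef_poly ltnS leq0n subn0; congr (_ && _).
  rewrite -horner_coef0 /ramif !expr2 hornerD !hornerM !horner_coef0
    !coef_deriv !mulr1n -!expr2.
  rewrite !coef_poly /= !subn0 !subn1; case: M {absM abs2M const} => [|M] /=.
    by rewrite !muln0 /= !expr0n mulr0 addr0 eqxx.
  by [].
split.
  move=> /and5P[h0 sh sf cop inf]; split=> //; last first.
    rewrite negb_and negb_or; case/orP: inf => [->//|inf]; rewrite inf andbT.
    have [M0|//] := eqVneq M 0%N; last by rewrite orbT.
    by rewrite (const M0 h0) // (leq_trans sh) // M0.
  (* If the coefficient of x^M in [h] is 0, that of x^(2M-1) or x^(2M) in [f] is nonzero. *)
  have := size_h h0; have : (2 * M <= (maxn (2 * (size h).-1) (size f).-1).+1)%N.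
    case: (posnP M) => [->//|M0].
    case/orP: inf => [/size_gt_coef sM|inf].
      by move: sM; set a := size h; set b := size f; clearbody a b; clear; lia.
    have : (2 * M <= size f)%N.
      have [f1|/size_gt_coef] := eqVneq f`_(2 * M).-1 0; last by move: M0;
        set b := size f; clearbody b; clear; lia.
      have [f2|/size_gt_coef] := eqVneq f`_(2 * M) 0; last by set b := size f;
        clearbody b; clear; lia.
      by move: inf; rewrite f1 f2 mul0r expr0n addr0 eqxx.
    by set a := size h; set b := size f; clearbody a b; clear; lia.
  move: sh sf; set a := size h; set b := size f; clearbody a b; clear.
  lia.
case=> h0 /andP[_ d] cop inf.
have [sh sf] : (size h <= M.+1)%N /\ (size f <= (2 * M).+1)%N.
  move: d; set a := size h; set b := size f; clearbody a b; clear.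
  move=> d; lia.
apply/and5P; split=> //.
move: inf; rewrite negb_and negb_or => /orP[->//|/andP[_ ->]]; exact: orbT.
Qed.

Lemma sum_Pg (k : finFieldType) M (G : {poly k} * {poly k} -> rat) :
  \sum_(hf \in Pg k (M%:Z - 1)) G hf =
  \sum_(x : npair k M | reduced_pair x) G (polyn x.1, polyn x.2).
Proof.
pose r := [seq (polyn x.1, polyn x.2) | x <- enum (@reduced_pair k M)].
have ur : uniq r.
  rewrite map_inj_uniq ?enum_uniq // => -[x1 x2] [y1 y2] /= [/val_inj ->
    /val_inj ->] //.
have -> : Pg k (M%:Z - 1) = [set` r]%classic.
  apply/seteqP; split=> -[h f] /=.
    move=> /reduced_Pg hf; have /and5P[_ sh sf _ _] := hf.
    by apply/mapP; exists (NPoly sh, NPoly sf); rewrite // mem_enum.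
  by move=> /mapP[x]; rewrite mem_enum => xr [-> ->]; apply/reduced_Pg.
by rewrite -fsbig_seq // big_map big_enum.
Qed.

(** Finiteness makes the finitely supported sum in [ug] an ordinary sum over this set, and the
    cardinality in [Jconst] a genuine one. *)
Lemma finite_An (k : finFieldType) (K : closedFieldType) (iota : {rmorphism k -> K})
    m (n : 'I_m -> nat) : (forall i, (1 <= n i)%N) -> finite_set (An k K n).
Proof.
move=> n_ge1.
pose s := flatten [seq None :: [seq Some x | x <- kextseq k K (n i)] | i <-
  enum 'I_m].
apply: (@sub_finite_set _ _ ((fun f : {ffun 'I_m -> seq_sub s} => [ffun i =>
  ssval (f i)]) @` setT)%classic); last first.
  exact/finite_image/finite_finset.
move=> a [P1 _]; have as_ i : a i \in s.
  apply/flatten_mapP; exists i; first by rewrite mem_enum.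
  rewrite inE; case: (P1 i) => [[x kx <-]|->] //=; apply: map_f.
  by rewrite (mem_kextseq iota) //; apply/asboolP.
exists [ffun i => SeqSub (as_ i)] => //.
by apply/ffunP => i; rewrite !ffunE.
Qed.

(** * Summation over the tuples of points and conclusion *)

Local Open Scope classical_set_scope.
Local Open Scope ring_scope.

Theorem theorem9p11 (k : finFieldType) (K : closedFieldType)
  (iota : {rmorphism k -> K}) (iotaK : integralRange iota)
  (q_even : ~~ odd #|k|)
  (m : nat) (m_ge1 : (1 <= m)%N) (n r : 'I_m -> nat)
  (n_ge1 : forall i, (1 <= n i)%N)
  (r_12 : forall i, r i = 1%N \/ r i = 2%N)
  (g : int) (g_ge : -1 <= g) :
  let q : rat := #|k|%:R in
  let S : rat := \sum_(0 <= j < (absz (g + 2)))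
                   bhat k n j * ug iota n r (g - j%:Z) in
  ((forall i, r i = 2%N) ->
     S = Jconst k K n * q ^ (g + 1) * bhat k n (absz (g + 1)))
  /\
  ((exists i, r i = 1%N) ->
     ((\sum_i n i)%N%:R - 3) / 2 <= g%:~R :> rat ->
     S = 0).
Proof.
move=> q S.
have [N gE] : exists N : nat, g = N%:Z - 1.
  by exists (absz (g + 1)); rewrite gez0_abs ?addrK // -lerBlDr sub0r.
have fA := finite_An iota n_ge1.
have r_gt0 i : (0 < r i)%N by case: (r_12 i) => ->.
have q0 : q != 0 by rewrite pnatr_eq0; have := finNzRing_gt1 k; case: #|k|.
have absN : absz (g + 1) = N by rewrite gE subrK.
have absN1 : absz (g + 2) = N.+1 by rewrite gE; lia.
pose total a := \sum_(x : npair k N | polyn x.1 != 0) weight iota n r a N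
  (polyn x.1) (polyn x.2).
(* The constant is I_g. The factor q^j in [weighted_sum_reduction] turns it into I_(g-j). *)
have SE : S = \sum_(a <- fset_set (An k K n)) (q ^- N.+1 * Iconst k) * total a.
  rewrite /S absN1 big_mkord.
  transitivity (\sum_(j < N.+1) \sum_(a <- fset_set (An k K n)) bhat k n j *
     (q ^- (N - j).+1 * Iconst k *
      \sum_(x : npair k (N - j) | reduced_pair x) weight iota n r a (N - j)
        (polyn x.1) (polyn x.2))).
    apply: eq_bigr => j _; rewrite -mulr_sumr; congr (_ * _).
    have jN : (j <= N)%N := ltn_ord j.
    have gj : g - j%:Z = (N - j)%N%:Z - 1 by rewrite gE; lia.
    rewrite /ug gj fsbig_finite //; apply: eq_bigr => a _; rewrite sum_Pg;
      congr (_ * _).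
      rewrite /Ig; congr (_ * _).
      by rewrite (_ : (N - j)%N%:Z - 1 + 2 = (N - j).+1%:Z) -?exprnN //; lia.
    apply: eq_bigr => x _; rewrite /weight /= subrK.
    by rewrite (_ : absz (2 * ((N - j)%N%:Z - 1) + 2) = (2 * (N - j))%N) //; lia.
  rewrite exchange_big; apply: eq_big_seq => a;
    rewrite in_fset_set // => /set_mem aA.
  rewrite /total (weighted_sum_reduction iota q_even m_ge1 n_ge1 r_gt0 aA)
    big_distrr /=.
  apply: eq_bigr => j _; rewrite -!/q.
  have -> : q ^+ N.+1 = q ^+ j * q ^+ (N - j).+1 by rewrite -exprD addnS subnKC
    // -ltnS.
  by field; rewrite ?expf_neq0.
split=> [r2|[i0 r1] gn].
  rewrite SE absN /Jconst.
  under eq_big_seq => a.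
    rewrite in_fset_set // => /set_mem aA.
    rewrite /total (sum_weight_sqr iota q_even m_ge1 n_ge1 aA N r2).
    over.
  rewrite big_const_seq count_predT iter_addr_0 -[LHS]mulr_natr gE subrK -exprnP.
  (* The power q^(N+1) cancels against I_g and leaves q^N, where N = g + 1. *)
  rewrite -!/q (_ : (2 * N).+1 = (N.+1 + N)%N) ?exprD; last by lia.
  by field; rewrite expf_neq0.
rewrite SE big_seq big1 // => a; rewrite in_fset_set // => /set_mem aA.
rewrite /total (sum_weight_odd iota q_even n_ge1 aA r1) ?mulr0 //.
(* With g = N - 1 the hypothesis on g reads |n| <= 2N + 1. *)
have E : (N%:Z - 1)%:~R * 2 + 3 = (2 * N + 1)%N%:R :> rat.
  rewrite rmorphB /= natrD natrM -[N%:~R]/(N%:R : rat); ring.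
move: gn; rewrite gE ler_pdivrMr // lerBlDr E ler_nat addn1 //.
Qed.
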